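(* Let $n \geq 1$. It is algorithmically undecidable whether a given non-commutative polynomial equation with parameters in $M_n(\mathbb Z)$ has a solution in $M_n(\mathbb N)$. It is also algorithmically undecidable whether a given non-commutative polynomial equation with parameters in $M_n(\mathbb Z)$ has a solution in $M_n(\mathbb Z)$. Moreover, it is sufficient to consider parameters in $M_n(\{0,1\})$: both problems remain undecidable when restricted to equations whose parameters lie in $M_n(\{0,1\})$.
   Context: $\mathbb N$ denotes the natural numbers including $0$. For a set $B$ of integers, $M_n(B)$ is the set of $n\times n$ matrices with entries in $B$. A non-commutative polynomial with integer coefficients is an element of the free associative unital ring over $\mathbb Z$ on its variables (the variables do not commute with each other). It is evaluated at $n\times n$ matrices using matrix addition and multiplication, where an integer $c$ occurring as a coefficient or as a free term is interpreted as $cI_n$, with $I_n$ the identity matrix. A non-commutative equation with parameters in a set $M\subseteq M_n(\mathbb Z)$ is a single equation $P(X_1,\dots,X_k,C_1,\dots,C_r)=0$, where $P$ is a non-commutative polynomial with integer coefficients in $k+r$ variables, $C_1,\dots,C_r\in M$ are given matrices (the parameters), and $X_1,\dots,X_k$ are the unknowns. The input of the decision problem consists of $P$ and the parameters $C_1,\dots,C_r$. A solution in $M_n(\mathbb N)$ (respectively in $M_n(\mathbb Z)$) is a tuple $(X_1,\dots,X_k)$ of matrices in that set satisfying the equation. Undecidable means that there is no algorithm (Turing machine) which on every input halts with the correct yes/no answer. *)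

(* Defs.v *)
From mathcomp Require Import all_boot all_order all_algebra.
From mathcomp Require Import finmap monalg.

Set Implicit Arguments.
Unset Strict Implicit.
Unset Printing Implicit Defensive.

Import GRing.Theory Num.Theory.

Local Open Scope ring_scope.

(* Deterministic one-tape Turing machines over a finite input alphabet [A].
   Tape symbols are [None] (the blank), input symbols [Some (inl a)] and
   auxiliary symbols [Some (inr g)]; [trans q s = None] means that the machine
   halts in state [q] when it scans [s]. *)

Inductive direction := MoveLeft | Stay | MoveRight.

Record turing_machine (A : finType) := TuringMachine {
  state : finType;
  aux : finType;
  start : state;
  accepting : pred state;
  trans : state -> option (A + aux) ->
          option (state * option (A + aux) * direction)
}.

Section TuringMachine.
Variables (A : finType) (M : turing_machine A).

Definition symbol := option (A + aux M).

(* The tape is infinite in both directions: [lefts] lists the symbols to the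
   left of the head, nearest first, [rights] those to its right, and all the
   cells beyond these lists are blank. *)
Record config := Config {
  control : state M;
  lefts : seq symbol;
  scanned : symbol;
  rights : seq symbol
}.

Definition init (w : seq A) : config :=
  let w' := [seq Some (inl a) | a <- w] in
  Config (start M) [::] (head None w') (behead w').

Definition move_head (d : direction) (c : config) : config :=
  let: Config q l s r := c in
  match d with
  | MoveLeft => Config q (behead l) (head None l) (s :: r)
  | Stay => c
  | MoveRight => Config q (s :: l) (head None r) (behead r)
  end.

(* A halted configuration is a fixed point of [step]. *)
Definition step (c : config) : config :=
  if trans (control c) (scanned c) is Some (q, s, d)
  then move_head d (Config q (lefts c) s (rights c)) else c.

Definition halted (c : config) : bool := ~~ trans (control c) (scanned c).

Definition halts_with (w : seq A) (b : bool) : Prop :=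
  exists t, let c := iter t step (init w) in halted c /\ accepting (control c) = b.

End TuringMachine.

(* A decision problem has inputs [x : T] satisfying [dom x], presented to the
   machine as any word [w] with [codes x w], and positive instances [yes].
   Nothing is required of the machine on words that code no input. *)
Definition decides (A : finType) (T : Type) (M : turing_machine A)
    (codes : T -> seq A -> Prop) (dom yes : T -> Prop) : Prop :=
  forall x w, dom x -> codes x w ->
    exists b : bool, halts_with M w b /\ (b <-> yes x).

Definition undecidable (A : finType) (T : Type)
    (codes : T -> seq A -> Prop) (dom yes : T -> Prop) : Prop :=
  ~ exists M : turing_machine A, decides M codes dom yes.

(* The monoid algebra of the free monoid is the free associative unital ring.
   In an equation its first [nunknowns] variables stand for the unknowns and its
   last [nparams] variables for the parameters. *)
Definition ncpoly (m : nat) := {malg int[{fmonom 'I_m}]}.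

Record nc_equation (n : nat) := NCEquation {
  nunknowns : nat;
  nparams : nat;
  eqn_poly : ncpoly (nunknowns + nparams);
  eqn_param : nparams.-tuple 'M[int]_n
}.

(* In size [n.+1] this is [mmap (fun c => c%:M) (fun w => \prod_(v <- w) a v) p];
   [mmap] does not apply to ['M[int]_n] because of the trivial ring ['M[int]_0]. *)
Definition nceval (n m : nat) (a : 'I_m -> 'M[int]_n) (p : ncpoly m) :
    'M[int]_n :=
  \sum_(w <- msupp p)
    (mcoeff w p)%:M *m \big[mulmx/1%:M]_(v <- (w : seq 'I_m)) a v.

Definition assignment (n k r : nat) (X : k.-tuple 'M[int]_n)
    (C : r.-tuple 'M[int]_n) (v : 'I_(k + r)) : 'M[int]_n :=
  match split v with inl i => tnth X i | inr j => tnth C j end.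

Definition has_params_in (n : nat) (B : {pred int}) (e : nc_equation n) : Prop :=
  forall j, tnth (eqn_param e) j \is a mxOver B.

Definition has_solution_in (n : nat) (B : {pred int}) (e : nc_equation n) : Prop :=
  exists X : (nunknowns e).-tuple 'M[int]_n,
    (forall i, tnth X i \is a mxOver B) /\
    nceval (assignment X (eqn_param e)) (eqn_poly e) = 0.

(* A polynomial is presented as a list of integer multiples of words; like
   terms need not be collected, and the terms may come in any order. *)
Definition terms (m : nat) := seq (int * {fmonom 'I_m}).

Definition poly_of_terms (m : nat) (ts : terms m) : ncpoly m :=
  \sum_(t <- ts) << t.1 *g t.2 >>.

Definition nats_of_int (c : int) : seq nat := [:: nat_of_bool (c < 0)%R; `|c|%N].

Definition nats_of_mx (n : nat) (C : 'M[int]_n) : seq nat :=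
  flatten [seq nats_of_int (C i j) | i <- enum 'I_n, j <- enum 'I_n].

Definition nats_of_term (m : nat) (t : int * {fmonom 'I_m}) : seq nat :=
  nats_of_int t.1 ++ size t.2 :: [seq val v | v <- (t.2 : seq 'I_m)].

(* [:: a1; a2; ...] becomes 1^a1 0 1^a2 0 ... *)
Definition unary (s : seq nat) : seq bool :=
  flatten [seq rcons (nseq a true) false | a <- s].

(* The word holds the numbers of unknowns and parameters, the entries of the
   parameters and then the terms up to the end of the word. Every block is
   self-delimiting, so a word codes at most one equation; every equation has a
   code since its polynomial is a finite sum of terms. Unary notation is
   harmless because only decidability, not complexity, is at stake. *)
Definition codes_equation (n : nat) (e : nc_equation n) (w : seq bool) : Prop :=
  exists ts : terms (nunknowns e + nparams e),
    poly_of_terms ts = eqn_poly e /\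
    w = unary (nunknowns e :: nparams e ::
               flatten (map (@nats_of_mx n) (eqn_param e)) ++
               flatten (map (@nats_of_term _) ts)).

(* Equations with parameters in M_n(B), solutions sought in M_n(S). *)
Definition undecidable_solvability (n : nat) (B S : {pred int}) : Prop :=
  undecidable (@codes_equation n) (has_params_in B) (has_solution_in S).

(* Main.v *)
Require Import Defs.
From mathcomp Require Import all_boot all_order all_algebra.
From mathcomp Require Import finmap monalg.
From mathcomp Require Import zify ring lra.
From Stdlib Require Import FunctionalExtensionality.

Set Implicit Arguments.
Unset Strict Implicit.
Unset Printing Implicit Defensive.

Import Order.TTheory GRing.Theory Num.Theory.

(** Suppose that a Turing machine [M] decides solvability. A diagonal argument
    then needs only two facts: that the runs of this single machine are
    Diophantine, and that an equation can mention its own code word.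

    Diophantine runs. A configuration of [M] is a control state together with
    two stacks of tape symbols; read in base [base M] the stacks are natural
    numbers, the blank being the digit 0, and a step of [M] becomes one of
    finitely many systems of linear equations between the old and the new
    numbers. Reachability in such an affine transition system is Diophantine
    ([dio_reach]): a whole run is packed into a few numbers in a large base that
    is a power of 2, each rule of the system acts linearly on the positions where
    it is used, and the selection of these positions is expressed by bitwise
    inclusion of binary expansions ([mask]). By the theorem of Lucas modulo 2
    this inclusion says that a binomial coefficient is odd; binomial coefficients
    are digits of a power ([bin_digit]), and the graph of exponentiation is
    Diophantine ([dfun_exp]). The last fact is proved with the solutions
    [pell_x a n], [pell_y a n] of the Pell equation x^2 - (a^2 - 1) y^2 = 1: their
    congruence properties let a system of polynomial equations pin down the
    index [n] ([pell_x_step_down], [pellsys_sound], [pellsys_complete]), and they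
    grow like powers and are congruent to powers ([pell_power]).

    Self-reference. Let the unknown 0 of an equation be tied to the number
    [q + 1] by the four terms of (X0 - (q + 1))^2, and let the other terms, those
    of a square P^2, not depend on [q]. In a code word the terms of P^2 come last;
    if they occupy the word [W], take for [q] the number of the tape that contains
    [W]. The tape number of the complete code word is then a Diophantine function
    of [q], because unary blocks are obtained from exponentials. So P can be chosen to
    express that [M] rejects the very word that codes (X0 - (q + 1))^2 + P^2 = 0,
    and [M] errs on this word.

    Matrices. With the matrix unit E = [delta_mx i0 i0] as parameter,
    E X E Y E is the product of the two [i0]-[i0] entries times E. Interleaving
    every monomial with E therefore turns an integer polynomial into a matrix
    polynomial with the same solvability, for solutions with entries in any
    set that contains 0 ([unit_eqn_solvable]). For integer solutions each
    natural unknown is replaced by a sum of four squares ([four_squares]). *)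

(** * Diophantine relations *)

(** Polynomials as syntax trees, so that substitution and the passage to lists of
    terms are structural recursions. *)
Inductive pexp := PV of nat | PC of int | PA of pexp & pexp | PM of pexp & pexp.

Fixpoint peval (z : nat -> int) (p : pexp) : int :=
  match p with
  | PV i => z i
  | PC c => c
  | PA p q => (peval z p + peval z q)%R
  | PM p q => (peval z p * peval z q)%R
  end.

Fixpoint psub (s : nat -> pexp) (p : pexp) : pexp :=
  match p with
  | PV i => s i
  | PC c => PC c
  | PA p q => PA (psub s p) (psub s q)
  | PM p q => PM (psub s p) (psub s q)
  end.

Lemma peval_psub z s p : peval z (psub s p) = peval (fun i => peval z (s i)) p.
Proof. by elim: p => //= p -> q ->. Qed.

Lemma eq_peval z z' p : z =1 z' -> peval z p = peval z' p.
Proof. by move=> E; elim: p => //= p -> q ->. Qed.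

Notation env := (nat -> nat).

(** The even variables carry the arguments of a relation, the odd ones its
    existential witnesses; both supplies are infinite. *)
Definition join (nu mu : env) (i : nat) : int :=
  Posz (if odd i then mu i./2 else nu i./2).

Definition dio (R : env -> Prop) :=
  exists p, forall nu, R nu <-> exists mu, peval (join nu mu) p = 0%R.

Definition dfun (f : env -> nat) :=
  dio (fun nu => nu 0 = f (fun i => nu i.+1)).

Lemma dio_iff R R' : (forall nu, R nu <-> R' nu) -> dio R -> dio R'.
Proof.
move=> E [p Hp]; exists p => nu; rewrite -Hp; split; by move/E.
Qed.

Definition on_even (i : nat) := PV i.*2.
Definition rename_vars (s r : nat -> nat) (i : nat) :=
  PV (if odd i then (r i./2).*2.+1 else (s i./2).*2).

Lemma peval_rename nu mu s r p : peval (join nu mu) (psub (rename_vars s r) p) =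
  peval (join (fun i => nu (s i)) (fun i => mu (r i))) p.
Proof.
rewrite peval_psub; apply: eq_peval => i; rewrite /join /rename_vars /=.
by case: (odd i); rewrite /= ?odd_double ?doubleK ?uphalf_double.
Qed.

Lemma dio_rename R s : dio R -> dio (fun nu => R (fun i => nu (s i))).
Proof.
case=> p Hp; exists (psub (rename_vars s id) p) => nu; rewrite Hp.
by split=> -[mu E]; exists mu; move: E; rewrite peval_rename.
Qed.

Definition interleave (mu1 mu2 : env) i := if odd i then mu2 i./2 else mu1 i./2.

Lemma interleave_even mu1 mu2 : (fun i => interleave mu1 mu2 i.*2) = mu1.
Proof.
by apply: functional_extensionality => i; rewrite /interleave odd_double doubleK.
Qed.

Lemma interleave_odd mu1 mu2 : (fun i => interleave mu1 mu2 i.*2.+1) = mu2.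
Proof.
apply: functional_extensionality => i.
by rewrite /interleave /= odd_double uphalf_double.
Qed.

(** A conjunction is one equation because a sum of two integer squares vanishes
    only if both do. Witnesses are kept apart by interleaving. *)
Lemma dio_and R1 R2 : dio R1 -> dio R2 -> dio (fun nu => R1 nu /\ R2 nu).
Proof.
move=> [p1 H1] [p2 H2].
pose q1 := psub (rename_vars id double) p1.
pose q2 := psub (rename_vars id (fun i => i.*2.+1)) p2.
exists (PA (PM q1 q1) (PM q2 q2)) => nu /=; rewrite H1 H2; split.
  case=> -[mu1 E1] [mu2 E2]; exists (interleave mu1 mu2).
  by rewrite !peval_rename interleave_even interleave_odd E1 E2 mulr0 addr0.
case=> mu E; have : peval (join nu mu) q1 = 0%R /\ peval (join nu mu) q2 = 0%R.
  by split; nia.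
by rewrite !peval_rename => -[E1 E2]; split; eexists; eassumption.
Qed.

Lemma dio_or R1 R2 : dio R1 -> dio R2 -> dio (fun nu => R1 nu \/ R2 nu).
Proof.
move=> [p1 H1] [p2 H2]; exists (PM p1 p2) => nu /=; rewrite H1 H2; split.
  by move=> -[[mu E]|[mu E]]; exists mu; rewrite E ?mul0r ?mulr0.
by move=> [mu /eqP]; rewrite mulf_eq0 => /orP[]/eqP E; [left|right]; exists mu.
Qed.

(** An arbitrary family of naturals can be quantified at once, since a
    polynomial reads only finitely many of them. *)
Lemma dio_exists_fun (R : env -> env -> Prop) :
  dio (fun nu => R (fun i => nu i.*2) (fun i => nu i.*2.+1)) ->
  dio (fun nu => exists z, R z nu).
Proof.
case=> p Hp.
(* The values [z i], [nu i], [mu i] belong to the variables [4 i], [4 i + 2],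
   [2 i + 1] before the substitution and [4 i + 3], [2 i], [4 i + 1] after it. *)
pose s i := if odd i then PV i./2.*2.*2.+1 else
  if odd i./2 then PV i./2./2.*2 else PV i./2./2.*2.*2.+3.
have E nu mu z : peval (join nu (interleave mu z)) (psub s p)
    = peval (join (interleave z nu) mu) p.
  rewrite peval_psub; apply: eq_peval => i; rewrite /join /s /interleave.
  case: (odd i) => /=.
    by rewrite /= !odd_double /= !uphalf_double odd_double doubleK.
  case: (odd i./2) => /=; first by rewrite odd_double doubleK.
  by rewrite !odd_double /= uphalf_double /= odd_double /= uphalf_double.
exists (psub s p) => nu; split.
  case=> z; move: (Hp (interleave z nu)); rewrite interleave_even interleave_odd => -> [mu Hmu].
  by exists (interleave mu z); rewrite E.
case=> mu Emu; exists (fun i => mu i.*2.+1).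
move: (Hp (interleave (fun i => mu i.*2.+1) nu)); rewrite interleave_even interleave_odd => ->.
exists (fun i => mu i.*2); rewrite -E -[RHS]Emu; apply: eq_peval => i; rewrite /join /interleave.
case: (odd i) => //; congr Posz; rewrite -[in RHS](odd_double_half i./2).
by case: (odd i./2).
Qed.

Lemma dio_exists (R : nat -> env -> Prop) :
  dio (fun nu => R (nu 0) (fun i => nu i.+1)) ->
  dio (fun nu => exists x, R x nu).
Proof.
move=> H; apply: (@dio_iff (fun nu => exists z : env, R (z 0) nu)).
  move=> nu; split=> [[z Hz]|[x Hx]]; first by exists (z 0).
  by exists (fun=> x).
apply: dio_exists_fun.
exact: (dio_rename (fun i => if i is j.+1 then j.*2.+1 else 0)) H.
Qed.

Lemma dio_base p : dio (fun nu => peval (fun i => Posz (nu i)) p = 0%R).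
Proof.
exists (psub on_even p) => nu; split=> [E|[mu]].
  exists nu; rewrite -E peval_psub; apply: eq_peval => i.
  by rewrite /on_even /= /join odd_double doubleK.
move=> E; rewrite -E peval_psub; apply: eq_peval => i.
by rewrite /on_even /= /join odd_double doubleK.
Qed.

Lemma dio_eq f g : dfun f -> dfun g -> dio (fun nu => f nu = g nu).
Proof.
move=> Hf Hg; apply: (@dio_iff (fun nu => exists x, x = f nu /\ x = g nu)).
  by move=> nu; split=> [[x [<- <-]]//|->]; exists (g nu).
by apply/dio_exists/dio_and.
Qed.

Lemma dfun_proj i : dfun (fun nu => nu i).
Proof.
apply: dio_iff (dio_base (PA (PV 0) (PM (PC (-1)) (PV i.+1)))) => nu /=.
by split; lia.
Qed.

Lemma dfun_const c : dfun (fun=> c).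
Proof.
apply: dio_iff (dio_base (PA (PV 0) (PC (- Posz c)))) => nu /=.
by split; lia.
Qed.

(** Substitution of a Diophantine function in a Diophantine relation, the
    remaining arguments being shared. *)
Lemma dio_comp R f : dio (fun nu => R (nu 0) (fun i => nu i.+1)) -> dfun f ->
  dio (fun nu => R (f nu) nu).
Proof.
move=> HR Hf; apply: (@dio_iff (fun nu => exists x, x = f nu /\ R x nu)).
  by move=> nu; split=> [[x [<-]]//|H]; exists (f nu).
exact/dio_exists/dio_and.
Qed.

Lemma dfun_rename f s : dfun f -> dfun (fun nu => f (fun i => nu (s i))).
Proof.
exact: (dio_rename (fun i => if i is j.+1 then (s j).+1 else 0)).
Qed.

Lemma dio_comp2 R f g : dio (fun nu => R (nu 0) (nu 1)) -> dfun f -> dfun g ->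
  dio (fun nu => R (f nu) (g nu)).
Proof.
move=> HR Hf; apply: (@dio_comp (fun y nu => R (f nu) y)).
apply: (@dio_comp (fun x nu => R x (nu 0))).
  exact: HR.
exact: (dfun_rename S).
Qed.

Lemma dio_comp3 R f g h : dio (fun nu => R (nu 0) (nu 1) (nu 2)) ->
  dfun f -> dfun g -> dfun h -> dio (fun nu => R (f nu) (g nu) (h nu)).
Proof.
move=> HR Hf Hg; apply: (@dio_comp (fun y nu => R (f nu) (g nu) y)).
apply: (@dio_comp (fun x nu => R (f (fun i => nu i.+1)) x (nu 0))); last exact: (dfun_rename S).
apply: (@dio_comp (fun x nu => R x (nu 0) (nu 1))); last exact: (dfun_rename (fun i => i.+2)).
exact: HR.
Qed.

Lemma dio_comp4 R f g h k : dio (fun nu => R (nu 0) (nu 1) (nu 2) (nu 3)) ->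
  dfun f -> dfun g -> dfun h -> dfun k ->
  dio (fun nu => R (f nu) (g nu) (h nu) (k nu)).
Proof.
move=> HR Hf Hg Hh; apply: (@dio_comp (fun y nu => R (f nu) (g nu) (h nu) y)).
apply: (@dio_comp (fun x nu => R (f (fun i => nu i.+1)) (g (fun i => nu i.+1)) x (nu 0)));
  last exact: (dfun_rename S).
apply: (@dio_comp (fun x nu => R (f (fun i => nu i.+2)) x (nu 0) (nu 1)));
  last exact: (dfun_rename (fun i => i.+2)).
apply: (@dio_comp (fun x nu => R x (nu 0) (nu 1) (nu 2)));
  last exact: (dfun_rename (fun i => i.+3)).
exact: HR.
Qed.

Lemma dfun_comp2 (F : nat -> nat -> nat) f g :
  dio (fun nu => nu 0 = F (nu 1) (nu 2)) -> dfun f -> dfun g ->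
  dfun (fun nu => F (f nu) (g nu)).
Proof.
move=> HF Hf Hg; apply: (dio_comp3 (R := fun x y z => x = F y z)) => //.
- exact: dfun_proj.
- exact: (dfun_rename S).
exact: (dfun_rename S).
Qed.

Lemma dfun_add f g : dfun f -> dfun g -> dfun (fun nu => f nu + g nu).
Proof.
apply: dfun_comp2.
apply: dio_iff (dio_base (PA (PV 0) (PM (PC (-1)) (PA (PV 1) (PV 2))))) => nu /=.
by split; lia.
Qed.

Lemma dfun_mul f g : dfun f -> dfun g -> dfun (fun nu => f nu * g nu).
Proof.
apply: dfun_comp2.
apply: dio_iff (dio_base (PA (PV 0) (PM (PC (-1)) (PM (PV 1) (PV 2))))) => nu /=.
by split; lia.
Qed.

Lemma dfun_S f : dfun f -> dfun (fun nu => (f nu).+1).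
Proof.
move=> H; apply: dio_iff (dfun_add H (dfun_const 1)) => nu; rewrite addn1; tauto.
Qed.

Lemma dio_leq f g : dfun f -> dfun g -> dio (fun nu => f nu <= g nu).
Proof.
apply: (dio_comp2 (R := fun x y => x <= y)).
apply: (@dio_iff (fun nu => exists x, nu 0 + x = nu 1)).
  move=> nu; split=> [[x <-]|H]; first exact: leq_addr.
  by exists (nu 1 - nu 0); rewrite subnKC.
by apply: dio_exists; apply: dio_eq; [apply: dfun_add|]; apply: dfun_proj.
Qed.

Lemma dio_True : dio (fun=> True).
Proof. by exists (PC 0) => nu; split=> // _; exists nu. Qed.

Lemma dio_modn_eq f g h : dfun f -> dfun g -> dfun h ->
  dio (fun nu => f nu = g nu %[mod h nu]).
Proof.
apply: (dio_comp3 (R := fun f g h => f = g %[mod h])).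
apply: (@dio_iff (fun nu => exists q r, nu 0 + nu 2 * q = nu 1 + nu 2 * r)).
  move=> nu; split=> [[q [r E]]|E].
    by rewrite -(modnMDl q) addnC mulnC E addnC mulnC modnMDl.
  exists (nu 1 %/ nu 2), (nu 0 %/ nu 2).
  rewrite {1}(divn_eq (nu 0) (nu 2)) {2}(divn_eq (nu 1) (nu 2)) E.
  lia.
apply/dio_exists/dio_exists/dio_eq; apply: dfun_add;
  do ?[exact: dfun_proj]; by apply: dfun_mul; apply: dfun_proj.
Qed.

Ltac dio_step := lazymatch goal with
  | |- dio (fun nu => @?A nu /\ @?B nu) => apply: dio_and
  | |- dio (fun nu => @?A nu \/ @?B nu) => apply: dio_or
  | |- dio (fun nu => exists x, @?A nu x) => apply: dio_exists; cbv beta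
  | |- dio (fun nu => is_true (leq (@?A nu) (@?B nu))) => apply: dio_leq
  | |- dio (fun nu => modn (@?A nu) (@?C nu) = modn (@?B nu) (@?C nu)) =>
    apply: dio_modn_eq
  | |- dio (fun nu => @eq nat (@?A nu) (@?B nu)) => apply: dio_eq
  | |- dfun _ => first [ assumption | apply: dfun_proj | apply: dfun_const
      | apply: dfun_S | apply: dfun_add | apply: dfun_mul ]
  end.
Ltac dio_auto := repeat dio_step.

(** * Pell's equation *)

Section PellEquation.
Local Open Scope ring_scope.

Lemma dvdzD d m n : (d %| m)%Z -> (d %| n)%Z -> (d %| m + n)%Z.
Proof. exact: rpredD. Qed.

Lemma dvdzB d m n : (d %| m)%Z -> (d %| n)%Z -> (d %| m - n)%Z.
Proof. exact: rpredB. Qed.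

Lemma dvdz_le d m : (d %| m)%Z -> 0 < m -> d <= m.
Proof. by rewrite dvdzE => /dvdn_leq; lia. Qed.

Lemma dvdzN d m : (d %| - m)%Z = (d %| m)%Z.
Proof. exact: rpredN. Qed.

Section Pell.
Variable a : int.

(** The solution [x + y * sqrt (a ^+ 2 - 1)] of index [n] is the [n]-th power of
    [a + sqrt (a ^+ 2 - 1)]. *)
Fixpoint pell (n : nat) : int * int :=
  if n is m.+1 then
    let: (x, y) := pell m in (a * x + (a ^+ 2 - 1) * y, x + a * y)
  else (1, 0).
Definition pell_x n := (pell n).1.
Definition pell_y n := (pell n).2.

Lemma pell_xS n : pell_x n.+1 = a * pell_x n + (a ^+ 2 - 1) * pell_y n.
Proof. by rewrite /pell_x /pell_y /=; case: (pell n). Qed.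

Lemma pell_yS n : pell_y n.+1 = pell_x n + a * pell_y n.
Proof. by rewrite /pell_x /pell_y /=; case: (pell n). Qed.

Lemma pell_eqn n : pell_x n ^+ 2 = (a ^+ 2 - 1) * pell_y n ^+ 2 + 1.
Proof.
elim: n => [|n IH]; first by rewrite /pell_x /pell_y /=; ring.
by rewrite pell_xS pell_yS; lra.
Qed.

Lemma pellD m n :
  pell_x (m + n) = pell_x m * pell_x n + (a ^+ 2 - 1) * pell_y m * pell_y n
  /\ pell_y (m + n) = pell_x m * pell_y n + pell_y m * pell_x n.
Proof.
elim: m => [|m [IHx IHy]]; first by rewrite add0n /pell_x /pell_y /=; split; ring.
by rewrite addSn !pell_xS !pell_yS IHx IHy; split; ring.
Qed.
Definition pell_xD m n := (pellD m n).1.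
Definition pell_yD m n := (pellD m n).2.

(** The identity 2 cosh u cosh v = cosh (u + v) + cosh (u - v). It yields all the
    reflections of the index used below. *)
Lemma pell_x_reflect s u : pell_x (s + u + u) + pell_x s = 2 * pell_x (s + u) * pell_x u.
Proof.
rewrite !pell_xD !pell_yD.
have /(congr1 (fun z => pell_x s * z)) := pell_eqn u.
lra.
Qed.

Hypothesis a_ge3 : 3 <= a.

Lemma pell_x_pell_y_ge n : 1 <= pell_x n /\ n%:Z <= pell_y n.
Proof.
elim: n => [|n [IHx IHy]] //; rewrite pell_xS pell_yS; split; nia.
Qed.

Lemma pell_x_ge1 n : 1 <= pell_x n. Proof. by case: (pell_x_pell_y_ge n). Qed.
Lemma pell_y_ge n : n%:Z <= pell_y n. Proof. by case: (pell_x_pell_y_ge n). Qed.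

Lemma pell_x_growth n : 2 * pell_x n < pell_x n.+1.
Proof. by rewrite pell_xS; have := pell_x_ge1 n; have := pell_y_ge n; nia. Qed.

Lemma pell_x_lt m n : (m < n)%N -> 2 * pell_x m < pell_x n.
Proof.
elim: n => // n IH; rewrite ltnS leq_eqVlt => /orP[/eqP ->|/IH H].
  exact: pell_x_growth.
by have := pell_x_growth n; have := pell_x_ge1 n; lia.
Qed.

Lemma pell_y_lt m n : (m < n)%N -> pell_y m < pell_y n.
Proof.
have S k : pell_y k < pell_y k.+1 by rewrite pell_yS; have := pell_x_ge1 k; have := pell_y_ge k; nia.
elim: n => // n IH; rewrite ltnS leq_eqVlt => /orP[/eqP ->//|/IH H].
by have := S n; lia.
Qed.

Lemma pell_y_pow n : a ^+ n <= pell_y n.+1.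
Proof.
elim: n => [|n IH]; first by rewrite pell_yS /pell_x /pell_y /=; lia.
by rewrite pell_yS exprS; have := pell_x_ge1 n.+1; nia.
Qed.

(** Descent: multiplying [x + y * sqrt (a ^+ 2 - 1)] by the inverse of the
    fundamental solution gives a solution with smaller [y]. *)
Lemma pell_complete x y : 0 <= x -> 0 <= y ->
  x ^+ 2 = (a ^+ 2 - 1) * y ^+ 2 + 1 -> exists n, x = pell_x n /\ y = pell_y n.
Proof.
move=> x0 y0; have [N] : exists N : nat, y <= N%:Z by exists `|y|%N; lia.
elim: N x y x0 y0 => [|N IH] x y x0 y0 yN E.
  have y00 : y = 0 by lia.
  exists 0%N; rewrite /pell_x /pell_y /=; subst y; split => //.
  have X : x ^+ 2 = 1 by rewrite E; ring.
  nia.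
have [y00|y1] : y = 0 \/ 1 <= y by lia.
  by apply: IH => //; lia.
have x1 : (a - 1) * y < x by nia.
have x2 : x <= a * y by nia.
have x4 : 0 <= a * x - (a ^+ 2 - 1) * y.
  rewrite leNgt; apply/negP => H.
  have : (a * x) ^+ 2 < ((a ^+ 2 - 1) * y) ^+ 2 by nia.
  have -> : (a * x) ^+ 2 = a ^+ 2 * ((a ^+ 2 - 1) * y ^+ 2 + 1) by rewrite -E; ring.
  nia.
have [n [Ex Ey]] := IH (a * x - (a ^+ 2 - 1) * y) (a * y - x) x4 ltac:(lia) ltac:(lia)
   ltac:(lra).
exists n.+1; rewrite pell_xS pell_yS -Ex -Ey; split; ring.
Qed.

Lemma pell_x_mod2 n s : (pell_x n %| pell_x (n + n + s) + pell_x s)%Z.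
Proof.
apply/dvdzP; exists (2 * pell_x (s + n)).
by rewrite addnC addnA pell_x_reflect.
Qed.

Lemma pell_x_mod_reflect n u : (u <= n)%N -> (pell_x n %| pell_x (n + u) + pell_x (n - u))%Z.
Proof.
move=> un; apply/dvdzP; exists (2 * pell_x u).
by have := pell_x_reflect (n - u) u; rewrite subnK // => ->; ring.
Qed.

Lemma pell_x_mod4 n q s : (pell_x n %| pell_x (q * (4 * n) + s) - pell_x s)%Z.
Proof.
elim: q => [|q IH]; first by rewrite subrr dvdz0.
have H1 := pell_x_mod2 n (n + n + (q * (4 * n) + s)).
have H2 := pell_x_mod2 n (q * (4 * n) + s).
have -> : (q.+1 * (4 * n) + s = n + n + (n + n + (q * (4 * n) + s)))%N by lia.
rewrite (_ : _ - _ = (pell_x (n + n + (n + n + (q * (4 * n) + s)))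
  + pell_x (n + n + (q * (4 * n) + s))) - (pell_x (n + n + (q * (4 * n) + s)) +
  pell_x (q * (4 * n) + s)) + (pell_x (q * (4 * n) + s) - pell_x s)); last by ring.
by apply: dvdzD => //; apply: dvdzB.
Qed.

(** Since [2 * pell_x m < pell_x n] for [m < n], the values [pell_x s] with
    [s <= n] and their opposites are distinct residues modulo [pell_x n], apart
    from the value 0 at [s = n]. This is where [3 <= a] matters: for [a = 2] the
    inequality degenerates to an equality at [n = 1]. *)
Lemma pell_x_inj_mod n i s : (i <= n)%N -> (s <= n)%N ->
  (pell_x n %| pell_x s - pell_x i)%Z -> s = i.
Proof.
wlog lt_si : s i / (s < i)%N => [W|] i_n s_n H.
  case: (ltngtP s i) => // lt_si; first exact: W.
  by apply/esym; apply: W => //; rewrite -dvdzN opprB.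
have L := pell_x_lt lt_si; have s1 := pell_x_ge1 s.
have : pell_x i <= pell_x n.
  move: i_n; rewrite leq_eqVlt => /orP[/eqP ->//|/pell_x_lt]; have := pell_x_ge1 i; lia.
move: H; rewrite -opprB dvdzN => /dvdz_le; lia.
Qed.

Lemma pell_x_opp_mod n i s : (i <= n)%N -> (s <= n)%N ->
  (pell_x n %| pell_x s + pell_x i)%Z -> s = n /\ i = n.
Proof.
move=> i_n s_n H.
have [/eqP sn|sn] : (s == n) \/ (s < n)%N by apply/orP; rewrite -leq_eqVlt.
  split=> //; apply: (pell_x_inj_mod (leqnn n) i_n).
  by case/dvdzP: H => c; rewrite sn => E; apply/dvdzP; exists (c - 2); lia.
have [/eqP i_n'|i_n'] : (i == n) \/ (i < n)%N by apply/orP; rewrite -leq_eqVlt.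
  suff: s = n by lia.
  apply: (pell_x_inj_mod (leqnn n) s_n).
  by case/dvdzP: H => c; rewrite i_n' => E; apply/dvdzP; exists (c - 2); lia.
have L1 := pell_x_lt sn; have L2 := pell_x_lt i_n'; have L3 := pell_x_ge1 s; have := pell_x_ge1 i.
by move/dvdz_le: H; lia.
Qed.

(** Modulo [pell_x n] the sequence [pell_x] is even, antiperiodic of period
    [2 * n], hence determined by its values up to [n]. *)
Lemma pell_x_fold n r : (r < 4 * n)%N -> exists2 s, (s <= n)%N &
  ((pell_x n %| pell_x r - pell_x s)%Z /\ (r = s \/ r + s = 4 * n)%N)
  \/ ((pell_x n %| pell_x r + pell_x s)%Z /\ (r + s = 2 * n \/ r = 2 * n + s)%N).
Proof.
move=> rn; have [rn1|rn1] := leqP r n.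
  by exists r => //; left; rewrite subrr; split; [exact: dvdz0|left].
have [rn2|rn2] := leqP r (2 * n).
  exists (2 * n - r)%N; first lia; right; split; last by left; lia.
  have := @pell_x_mod_reflect n (r - n) ltac:(lia).
  have -> : (n + (r - n) = r)%N by lia.
  by have -> : (n - (r - n) = 2 * n - r)%N by lia.
have H := pell_x_mod2 n (r - 2 * n).
have E : (n + n + (r - 2 * n) = r)%N by lia.
rewrite E in H.
have [rn3|rn3] := leqP r (3 * n).
  by exists (r - 2 * n)%N; [lia|right; split=> //; right; lia].
exists (4 * n - r)%N; first lia; left; split; last by right; lia.
have := @pell_x_mod_reflect n (r - 3 * n) ltac:(lia).
have -> : (n + (r - 3 * n) = r - 2 * n)%N by lia.
have -> : (n - (r - 3 * n) = 4 * n - r)%N by lia.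
move=> /(dvdzB H); rewrite opprD addrA -(addrA (pell_x r)) subrr addr0 //.
Qed.

(** A congruence between values of [pell_x] gives a congruence between indices. *)
Lemma pell_x_step_down n i j : (0 < n)%N -> (i <= n)%N -> (pell_x n %| pell_x j - pell_x i)%Z ->
  ((4 * n)%:Z %| j%:Z - i%:Z)%Z \/ ((4 * n)%:Z %| j%:Z + i%:Z)%Z.
Proof.
move=> n0 i_n H.
have [q [r [Ej rn]]] : exists q r, j = (q * (4 * n) + r)%N /\ (r < 4 * n)%N.
  exists (j %/ (4 * n))%N, (j %% (4 * n))%N; rewrite -divn_eq ltn_pmod //.
  by rewrite muln_gt0.
have {}H : (pell_x n %| pell_x r - pell_x i)%Z.
  have := dvdzB H (pell_x_mod4 n q r); rewrite -Ej; congr (_ %| _)%Z; ring.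
have [s s_n [[Hs rs]|[Hs rs]]] := pell_x_fold rn.
  have Esi : s = i.
    apply: (pell_x_inj_mod i_n s_n); have := dvdzB H Hs; congr (_ %| _)%Z; ring.
  move: Ej rs; rewrite {}Esi => -> {H Hs} [->|E].
    by left; rewrite PoszD addrK PoszM dvdz_mull.
  by right; rewrite -PoszD -addnA E -mulSnr PoszM dvdz_mull.
have [Es Ei] : s = n /\ i = n.
  by apply: (pell_x_opp_mod i_n s_n); have := dvdzB Hs H; congr (_ %| _)%Z; ring.
move: rs; rewrite Es => rs; rewrite Ei Ej.
have [->|->] : r = n \/ r = (3 * n)%N by lia.
  by left; rewrite PoszD addrK PoszM dvdz_mull.
by right; rewrite -PoszD -addnA -mulSnr -mulSnr PoszM dvdz_mull.
Qed.

(** Expansion of the [k]-th power of the solution of index [n] to first order in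
    [pell_y n]. *)
Lemma pell_mul_mod n k : [/\ (pell_y n %| pell_y (n * k))%Z, (pell_y n %| pell_x (n * k) - pell_x n ^+ k)%Z
  & (pell_y n ^+ 2 %| pell_y (n * k.+1) - k.+1%:Z * pell_x n ^+ k * pell_y n)%Z].
Proof.
elim: k => [|k [/dvdzP[c1 H1] /dvdzP[c2 H2] /dvdzP[c3 H3]]].
  rewrite muln0 muln1; split; [exact: dvdz0|by rewrite subrr dvdz0|].
  by rewrite (_ : _ - _ = 0) ?dvdz0 //; ring.
have E1 : (pell_y n %| pell_y (n * k.+1))%Z.
  apply/dvdzP; exists (pell_x (n * k) + c1 * pell_x n); rewrite mulnS addnC pell_yD H1; ring.
have E2 : (pell_y n %| pell_x (n * k.+1) - pell_x n ^+ k.+1)%Z.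
  apply/dvdzP; exists (c2 * pell_x n + (a ^+ 2 - 1) * pell_y (n * k)).
  rewrite mulnS addnC pell_xD (exprS _ k).
  have -> : pell_x (n * k) = c2 * pell_y n + pell_x n ^+ k by lia.
  move: (pell_x n ^+ k) => z; ring.
split => //; case/dvdzP: E2 => c4 H4.
apply/dvdzP; exists (c4 + c3 * pell_x n).
rewrite [in LHS]mulnS addnC pell_yD.
have -> : pell_x (n * k.+1) = c4 * pell_y n + pell_x n ^+ k.+1 by lia.
have -> : pell_y (n * k.+1) = c3 * pell_y n ^+ 2 + k.+1%:Z * pell_x n ^+ k * pell_y n by lia.
by rewrite (exprS _ k) intS (intS k.+1); move: (pell_x n ^+ k) => z; ring.
Qed.

Lemma pell_x_coprime_pell_y n : coprimez (pell_x n) (pell_y n).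
Proof.
apply/coprimezP; exists (pell_x n, - (a ^+ 2 - 1) * pell_y n) => /=.
by have := pell_eqn n; lra.
Qed.

Lemma pell_y_dvd n m : (pell_y n %| pell_y m)%Z -> (n %| m)%N.
Proof.
rewrite {1}(divn_eq m n) mulnC pell_yD.
have [H _ _] := pell_mul_mod n (m %/ n).
rewrite rpredDr; last by apply: dvdz_mulr.
have co : coprimez (pell_y n) (pell_x (n * (m %/ n))).
  rewrite coprimez_sym; apply/coprimezP.
  case/dvdzP: H => c E; exists (pell_x (n * (m %/ n)), - (a ^+ 2 - 1) * pell_y (n * (m %/ n)) * c) => /=.
  by have := pell_eqn (n * (m %/ n)); move: E; move: (pell_y (n * _)) (pell_x (n * _)) => y x ->; lra.
rewrite Gauss_dvdzr // => H2.
have [n0|n0] := posnP n.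
  by move: H2; rewrite n0 modn0 dvd0z => /eqP y0; have := pell_y_ge m; rewrite y0; case: m {H co y0}.
rewrite /dvdn; have := pell_y_lt (ltn_pmod m n0); move: (m %% n)%N H2 => r /dvdz_le.
by case: r => // r H2; have := pell_y_ge r.+1; lia.
Qed.

(** By the first-order expansion, [pell_y n ^+ 2] divides [pell_y (n * k)] only if
    [pell_y n] divides [k]. *)
Lemma pell_y_sq_dvd n m : (0 < n)%N -> (pell_y n ^+ 2 %| pell_y m)%Z -> (pell_y n %| m%:Z)%Z.
Proof.
move=> n0 H; have y0 : pell_y n != 0 by have := pell_y_ge n; lia.
have /pell_y_dvd /dvdnP[k Em] : (pell_y n %| pell_y m)%Z by apply: dvdz_trans H; exact: dvdz_mulr.
subst m; move: H; case: k => [|k]; first by rewrite mul0n dvdz0.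
rewrite mulnC; have [_ _ H] := pell_mul_mod n k.
move/dvdzB => /(_ _ H); rewrite opprB addrC subrK expr2 dvdz_mul2r //.
rewrite Gauss_dvdzl; first by rewrite mulnC PoszM => /dvdz_mulr ->.
by rewrite coprimez_sym coprimezXl // pell_x_coprime_pell_y.
Qed.
End Pell.

Lemma pell_congr a b k :
  (b - a %| pell_x b k - pell_x a k)%Z /\ (b - a %| pell_y b k - pell_y a k)%Z.
Proof.
elim: k => [|k [/dvdzP[c1 H1] /dvdzP[c2 H2]]]; first by rewrite subrr dvdz0.
rewrite !pell_xS !pell_yS; have -> : pell_x b k = pell_x a k + c1 * (b - a) by lia.
have -> : pell_y b k = pell_y a k + c2 * (b - a) by lia.
split; apply/dvdzP.
  exists (b * c1 + pell_x a k + (b ^+ 2 - 1) * c2 + (b + a) * pell_y a k); ring.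
exists (c1 + b * c2 + pell_y a k); ring.
Qed.

Lemma pell_y_mod_index a k : (a - 1 %| pell_y a k - k%:Z)%Z.
Proof.
have H : (a - 1 %| pell_x a k - 1)%Z /\ (a - 1 %| pell_y a k - k%:Z)%Z.
  elim: k => [|k [/dvdzP[c1 H1] /dvdzP[c2 H2]]]; first by rewrite /pell_x /pell_y /= subrr dvdz0.
  rewrite !pell_xS !pell_yS; have -> : pell_x a k = 1 + c1 * (a - 1) by lia.
  have -> : pell_y a k = k%:Z + c2 * (a - 1) by lia.
  split; apply/dvdzP.
    exists (1 + a * c1 + (a + 1) * (k%:Z + c2 * (a - 1))); ring.
  by exists (c1 + a * c2 + k%:Z); rewrite intS; ring.
by case: H.
Qed.

(** The polynomial [z ^+ 2 - 2 * a * z + 1], whose roots are the fundamental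
    solution and its conjugate, vanishes at [m] modulo this modulus; so the
    fundamental solution behaves like [m] there. *)
Lemma pell_power a m k :
  (2 * a * m - m ^+ 2 - 1 %| pell_x a k - (a - m) * pell_y a k - m ^+ k)%Z.
Proof.
elim: k => [|k /dvdzP[c H]]; first by rewrite /pell_x /pell_y /= expr0 mulr0 subr0 subrr dvdz0.
apply/dvdzP; exists (pell_y a k + m * c).
rewrite pell_xS pell_yS (exprS m).
have -> : m ^+ k = pell_x a k - (a - m) * pell_y a k - c * (2 * a * m - m ^+ 2 - 1) by lia.
ring.
Qed.

End PellEquation.

(** * The graph of exponentiation is Diophantine *)

Lemma PoszX (m n : nat) : Posz (m ^ n) = (Posz m ^+ n)%R.
Proof. by elim: n => // n IH; rewrite expnS PoszM IH exprS. Qed.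

Definition pellrel (a k x y : nat) := pell_x a k = x /\ pell_y a k = y.

Lemma pell_complete_nat (a x y : nat) : 3 <= a ->
  (x * x + y * y = a * a * y * y + 1 <-> exists n, pellrel a n x y).
Proof.
move=> a3; split=> [E|[n [Ex Ey]]].
  have [||||n [Ex Ey]] := @pell_complete a _ x y; try lia.
  by exists n; split.
have := pell_eqn a n; rewrite Ex Ey => E.
nia.
Qed.

Lemma eqn_modz (m x y : nat) : (x = y %[mod m]) <-> (Posz m %| (Posz x - Posz y)%R)%Z.
Proof.
rewrite -eqz_mod_dvd; split=> [E|/eqP].
  by apply/eqP; rewrite !modz_nat E.
by rewrite !modz_nat => -[].
Qed.

(** Here [x, y] is the solution of some index [i] for [a], [u, v] that of some [n],
    and [s, t] that of some [j] for a second coefficient [b]. The congruences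
    force [j = k] modulo [4 * y] because [b = 1] modulo [4 * y], and [j = i] or
    [j = - i] modulo [4 * n] because [b = a] modulo [u]; the divisibility of [v] by
    [y * y] makes [4 * y] divide [4 * n]. As [i, k <= y], this leaves [i = k]. *)
Definition pellsys (a k x y : nat) :=
  (k = 0 /\ x = 1 /\ y = 0) \/
  (0 < k /\ k <= y /\ exists u v s t b : nat,
    x * x + y * y = a * a * y * y + 1 /\ u * u + v * v = a * a * v * v + 1 /\
    s * s + t * t = b * b * t * t + 1 /\ 3 <= b /\ 0 < v /\ b = a %[mod u] /\
    b = 1 %[mod 4 * y] /\ v = 0 %[mod y * y] /\ s = x %[mod u] /\ t = k %[mod 4 * y]).

Lemma pellrel_exists (a : nat) n : 3 <= a -> exists x y, pellrel a n x y.
Proof.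
move=> a3; exists `|pell_x a n|%N, `|pell_y a n|%N.
by split; have := pell_x_ge1 (a := a) ltac:(lia) n; have := pell_y_ge (a := a) ltac:(lia) n; lia.
Qed.

Lemma pellsys_sound a k x y : 3 <= a -> pellsys a k x y -> pellrel a k x y.
Proof.
move=> a3 [[-> [-> ->]] //|[k0 [ky [u [v [s [t [b [E1 [E2 [E3 [b3 [v0 C]]]]]]]]]]]]].
have /(pell_complete_nat _ _ a3) [i [Ex Ey]] := E1.
have /(pell_complete_nat _ _ a3) [n [Eu Ev]] := E2.
have /(pell_complete_nat _ _ b3) [j [Es Et]] := E3; clear E1 E2 E3.
have a3' : (3 <= Posz a)%R by lia.
have b3' : (3 <= Posz b)%R by lia.
suff -> : k = i by [].
move: C.
have n0 : 0 < n.
  by rewrite lt0n; apply/eqP => n0; move: Ev v0; rewrite n0 /pell_y /= => -[<-].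
have iy : i <= y by have := pell_y_ge a3' i; lia.
have i0 : 0 < i.
  by rewrite lt0n; apply/eqP => i0; move: Ey ky; rewrite i0 /pell_y /= => -[<-]; lia.
move=> [/eqn_modz C1 [/eqn_modz C2 [/eqn_modz C3 [/eqn_modz C4 /eqn_modz C5]]]].
have yn : (Posz y %| Posz n)%Z.
  rewrite -Ey; apply: (pell_y_sq_dvd a3' i0); rewrite Ey Ev.
  by move: C3; rewrite subr0 expr2 PoszM.
have i_n : i <= n by apply: leq_trans iy _; apply: dvdn_leq.
have step : (pell_x a n %| (pell_x a j - pell_x a i)%R)%Z.
  have [H _] := pell_congr (Posz a) b j.
  have {}H := dvdz_trans C1 (n := _) H.
  rewrite Es in H; rewrite Eu Ex.
  have := dvdzB C4 H; congr (_ %| _)%Z; ring.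
have d4 m : (Posz (4 * n)%N %| m)%Z -> (Posz (4 * y)%N %| m)%Z.
  by apply: dvdz_trans; rewrite !PoszM; apply: dvdz_mul.
have tj : (Posz (4 * y)%N %| (Posz t - Posz j)%R)%Z.
  by rewrite -Et; apply: dvdz_trans C2 (pell_y_mod_index _ _).
have kj : (Posz (4 * y)%N %| (Posz j - Posz k)%R)%Z.
  by have := dvdzB C5 tj; congr (_ %| _)%Z; ring.
have [/d4 H|/d4 H] := pell_x_step_down a3' n0 i_n step.
  have {}H : (Posz (4 * y)%N %| (Posz k - Posz i)%R)%Z.
    by have := dvdzB H kj; congr (_ %| _)%Z; ring.
  clear -H ky iy k0 i0.
  case: (ltngtP k i) => // L.
    by move: H; rewrite -dvdzN => /dvdz_le; lia.
  by move: H => /dvdz_le; lia.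
have {}H : (Posz (4 * y)%N %| (Posz k + Posz i)%R)%Z.
  by have := dvdzB H kj; congr (_ %| _)%Z; ring.
clear -H ky iy k0 i0.
by move: H => /dvdz_le; lia.
Qed.

(** Take [n = 2 * k * y]: then [y * y] divides [v] and [u] is coprime to [4 * y], so
    that [b] exists by the Chinese remainder theorem. *)
Lemma pellsys_complete a k x y : 3 <= a -> pellrel a k x y -> pellsys a k x y.
Proof.
move=> a3 [Ex Ey]; have a3' : (3 <= Posz a)%R by lia.
have [k0|k0] := posnP k.
  by left; move: Ex Ey; rewrite k0 /pell_x /pell_y /= => -[<-] [<-].
right; have ky : k <= y by have := pell_y_ge a3' k; lia.
split=> //; split=> //.
set m := k * y; have m0 : 0 < m by rewrite muln_gt0 k0; lia.
have [v1 [v2 [E1 E2]]] := pellrel_exists m a3.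
have [u [v [Eu Ev]]] := pellrel_exists (m + m) a3.
have Dv : v = 2 * v1 * v2 by move: Ev; rewrite pell_yD E1 E2; lia.
have ysq : (Posz (y * y)%N %| pell_y a m)%Z.
  have y0 : 0 < y by lia.
  have [_ _] := pell_mul_mod a3' k y.-1.
  rewrite (prednK y0) Ey expr2 -PoszM -/m => H.
  have /(dvdzD H) : (Posz (y * y)%N %| (Posz y * pell_x a k ^+ y.-1 * Posz y)%R)%Z.
    apply/dvdzP; exists (pell_x a k ^+ y.-1)%R.
    by rewrite PoszM; move: (_ ^+ y.-1)%R => z; ring.
  by rewrite subrK.
have v20 : 0 < v2 by have := pell_y_ge a3' m; lia.
have v10 : 0 < v1 by have := pell_x_ge1 a3' m; lia.
have yv : y * y %| v by rewrite Dv; move: ysq; rewrite E2 dvdzE /=; apply: dvdn_mull.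
have Eq := pell_eqn a (m + m); rewrite Eu Ev in Eq.
have co : coprime u (4 * y).
  rewrite (_ : 4 * y = 2 * (2 * y)); last lia.
  have cuv : coprime u v.
    by have := pell_x_coprime_pell_y a (m + m); rewrite Eu Ev coprimezE.
  have c2 : coprime u 2.
    by apply: coprime_dvdr cuv; rewrite Dv -mulnA dvdn_mulr.
  rewrite !coprimeMr c2 /=; apply: coprime_dvdr cuv.
  by apply: dvdn_trans yv; apply: dvdn_mulr.
set b := chinese u (4 * y) a 1 + 3 * (u * (4 * y)).
have u0 : 0 < u by have := pell_x_ge1 a3' (m + m); lia.
have b3 : 3 <= b.
  apply: leq_trans (leq_addl _ _); rewrite -{1}(muln1 3) leq_mul2l /=.
  by rewrite !muln_gt0 u0; lia.
have b1 : b = a %[mod u] by rewrite /b -modnDmr mulnCA modnMr addn0 chinese_modl.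
have b2 : b = 1 %[mod 4 * y].
  by rewrite /b -modnDmr mulnA modnMl addn0 chinese_modr.
have [s [t [Es Et]]] := pellrel_exists k b3.
exists u, v, s, t, b; split; first by apply/(pell_complete_nat _ _ a3); exists k.
split; first by apply/(pell_complete_nat _ _ a3); exists (m + m).
split; first by apply/(pell_complete_nat _ _ b3); exists k.
split=> //; split; first by rewrite Dv !muln_gt0 v10.
split=> //; split=> //; split; first by rewrite mod0n; apply/eqP.
split; apply/eqn_modz.
  have [H _] := pell_congr (Posz a) b k.
  by move: H; rewrite Ex Es; apply: dvdz_trans; apply/eqn_modz.
by rewrite -Et; apply: dvdz_trans (pell_y_mod_index _ _); apply/eqn_modz.
Qed.

Definition pell3 (a k x y : nat) := 3 <= a /\ pellrel a k x y.

Lemma dio_pell f g h k : dfun f -> dfun g -> dfun h -> dfun k ->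
  dio (fun nu => pell3 (f nu) (g nu) (h nu) (k nu)).
Proof.
apply: (@dio_comp4 pell3).
apply: (@dio_iff (fun nu => 3 <= nu 0 /\ pellsys (nu 0) (nu 1) (nu 2) (nu 3))).
  by move=> nu; split=> -[a3 H]; split=> //; [exact: pellsys_sound|exact: pellsys_complete].
rewrite /pellsys; dio_auto.
Qed.

(** [n ^ k] is determined by [pell_power] as soon as the modulus [T] exceeds it;
    the choice of [a] ensures this because [pell_y c k.+1 >= c ^ k]. *)
Definition powsys (n k m : nat) := exists a0 x0 a x y T,
  pell3 (n + 3) k.+1 x0 a0 /\ a = n + 3 + a0 /\
  pell3 a k x y /\ T + n * n + 1 = 2 * a * n /\ m < T /\
  x + n * y = a * y + m %[mod T].

Lemma powsysP n k m : 0 < n -> powsys n k m <-> m = n ^ k.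
Proof.
move=> n0.
have key a0 x0 a x y T : pellrel (n + 3) k.+1 x0 a0 -> a = n + 3 + a0 ->
    pellrel a k x y -> T + n * n + 1 = 2 * a * n ->
    n ^ k < T /\ x + n * y = a * y + n ^ k %[mod T].
  move=> [_ E0] Ea [Ex Ey] ET; split.
    have := @pell_y_pow (Posz (n + 3)) ltac:(lia) k; rewrite E0 -PoszX.
    have : n ^ k <= (n + 3) ^ k by case: (k) => // j; rewrite leq_exp2r ?leq_addr.
    move: (n ^ k) ((n + 3) ^ k) => p q; nia.
  apply/eqn_modz; have := pell_power a n k.
  have -> : (2 * Posz a * n - Posz n ^+ 2 - 1 = T)%R by lia.
  rewrite Ex Ey; congr (_ %| _)%Z; rewrite !PoszD !PoszM -PoszX; ring.
split.
  move=> [a0 [x0 [a [x [y [T [[_ H0] [Ea [[_ H1] [ET [mT C]]]]]]]]]]].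
  have [L C'] := key _ _ _ _ _ _ H0 Ea H1 ET.
  move: C; rewrite C' => /eqP; rewrite eqn_modDl => /eqP.
  by rewrite !modn_small.
move=> ->; have [x0 [a0 H0]] := @pellrel_exists (n + 3) k.+1 ltac:(lia).
have a3 : 3 <= n + 3 + a0 by lia.
have [x [y H1]] := @pellrel_exists _ k a3.
have ET : (2 * (n + 3 + a0) * n - n * n - 1) + n * n + 1 = 2 * (n + 3 + a0) * n by nia.
have [L C] := key _ _ _ _ _ _ H0 erefl H1 ET.
exists a0, x0, (n + 3 + a0), x, y, (2 * (n + 3 + a0) * n - n * n - 1).
by split; [split; [lia|]|].
Qed.

Lemma dfun_exp f g : dfun f -> dfun g -> dfun (fun nu => f nu ^ g nu).
Proof.
apply: dfun_comp2.
apply: (@dio_iff (fun nu => (nu 1 = 0 /\ nu 2 = 0 /\ nu 0 = 1) \/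
   (nu 1 = 0 /\ 0 < nu 2 /\ nu 0 = 0) \/ (0 < nu 1 /\ powsys (nu 1) (nu 2) (nu 0)))).
  move=> nu; split.
    case=> [[-> [-> ->]]//|[[-> [H ->]]|[H1 /powsysP ->//]]].
    by rewrite exp0n.
  move=> ->; case: (posnP (nu 1)) => [->|H].
    by case: (posnP (nu 2)) => [->|H]; [left|right; left; rewrite exp0n].
  by right; right; split=> //; apply/powsysP.
rewrite /powsys; dio_auto. all: apply: dio_pell; dio_auto.
Qed.

(** * Digits, binomial coefficients and binary masking *)

Definition digit_sum (Q t : nat) (f : nat -> nat) := \sum_(i < t) f i * Q ^ i.

Lemma digit_sum0 Q f : digit_sum Q 0 f = 0.
Proof. exact: big_ord0. Qed.

Lemma digit_sumS Q t f : digit_sum Q t.+1 f = f 0 + Q * digit_sum Q t (fun i => f i.+1).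
Proof.
rewrite /digit_sum big_ord_recl expn0 muln1 big_distrr /=; congr (_ + _).
by apply: eq_bigr => i _; rewrite expnS; ring.
Qed.

Lemma digit_sumSr Q t f : digit_sum Q t.+1 f = digit_sum Q t f + f t * Q ^ t.
Proof. exact: big_ord_recr. Qed.

Lemma eq_digit_sum Q t f g : (forall i, i < t -> f i = g i) -> digit_sum Q t f = digit_sum Q t g.
Proof. by move=> E; apply: eq_bigr => i _; rewrite E. Qed.

Lemma digit_sum_cat Q s t f :
  digit_sum Q (s + t) f = digit_sum Q s f + Q ^ s * digit_sum Q t (fun i => f (s + i)).
Proof.
elim: s f => [|s IH] f; first by rewrite add0n digit_sum0 mul1n.
rewrite addSn !digit_sumS IH mulnDr mulnA addnA -expnS; congr (_ + _ * _).
Qed.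

Lemma digit_sum_lt Q t f : (forall i, i < t -> f i < Q) -> digit_sum Q t f < Q ^ t.
Proof.
elim: t => [|t IH] H; first by rewrite digit_sum0.
rewrite digit_sumSr expnS; have := IH (fun i it => H i (ltnW it)); have := H t (ltnSn t).
move: (digit_sum Q t f) (f t) (Q ^ t) => a b c; nia.
Qed.

Lemma digit_sum_inj Q t f g : (forall i, i < t -> f i < Q) -> (forall i, i < t -> g i < Q) ->
  digit_sum Q t f = digit_sum Q t g -> forall i, i < t -> f i = g i.
Proof.
elim: t f g => // t IH f g Hf Hg; rewrite !digit_sumS => E.
have E0 : f 0 = g 0.
  have := congr1 (modn^~ Q) E; rewrite !(addnC (_ 0)) !(mulnC Q) !modnMDl.
  by rewrite !modn_small ?Hf ?Hg.
have Q0 : 0 < Q by apply: leq_ltn_trans (Hf 0 _).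
case=> // i it; apply: (IH (fun i => f i.+1) (fun i => g i.+1)) => //.
- by move=> j jt; apply: Hf.
- by move=> j jt; apply: Hg.
apply/eqP; rewrite -(eqn_pmul2l Q0); apply/eqP; lia.
Qed.

Lemma digit_sumD Q t f g : digit_sum Q t (fun i => f i + g i) = digit_sum Q t f + digit_sum Q t g.
Proof. by rewrite -big_split; apply: eq_bigr => i _; rewrite mulnDl. Qed.

Lemma digit_sumM Q t c f : digit_sum Q t (fun i => c * f i) = c * digit_sum Q t f.
Proof. by rewrite /digit_sum big_distrr /=; apply: eq_bigr => i _; rewrite mulnA. Qed.

Lemma dfun_divn f g : dfun f -> dfun g -> dfun (fun nu => f nu %/ g nu).
Proof.
apply: dfun_comp2.
apply: (@dio_iff (fun nu => (nu 2 = 0 /\ nu 0 = 0) \/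
  exists r, nu 1 = nu 0 * nu 2 + r /\ r < nu 2)).
  move=> nu; split.
    case=> [[-> ->]|[r [-> rn]]]; first by rewrite divn0.
    by rewrite divnMDl ?divn_small ?addn0 //; apply: leq_ltn_trans rn.
  case: (posnP (nu 2)) => [->|H ->]; first by rewrite divn0; left.
  by right; exists (nu 1 %% nu 2); rewrite -divn_eq ltn_mod.
dio_auto.
Qed.

Lemma dfun_modn f g : dfun f -> dfun g -> dfun (fun nu => f nu %% g nu).
Proof.
apply: dfun_comp2.
apply: (@dio_iff (fun nu => nu 1 = nu 1 %/ nu 2 * nu 2 + nu 0)).
  move=> nu; split=> [E|->]; last exact: divn_eq.
  by move: E; rewrite {1}(divn_eq (nu 1) (nu 2)) => /addnI.
by dio_auto; apply: dfun_divn; dio_auto.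
Qed.

(** The binomial coefficients [C(n, i)] are at most [2 ^ n], hence are the digits of
    [(u + 1) ^ n] in base [u = 2 ^ n + 1]. *)
Lemma bin_digit n k : 'C(n, k) = (2 ^ n).+2 ^ n %/ (2 ^ n).+1 ^ k %% (2 ^ n).+1.
Proof.
set u := (2 ^ n).+1; have u0 : 0 < u by [].
have dig i : 'C(n, i) < u.
  rewrite ltnS -[in leqRHS](addn1 1) expnDn.
  have [in_|ni] := leqP i n; last by rewrite bin_small.
  by rewrite (bigD1 (Ordinal (in_ : i < n.+1))) //= !exp1n !muln1 leq_addr.
have E : (2 ^ n).+2 ^ n = digit_sum u (k + n.+1) (fun i => 'C(n, i)).
  rewrite addnC digit_sum_cat [X in _ + _ * X]big1 ?muln0 ?addn0; last first.
    by move=> i _; rewrite bin_small //; lia.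
  rewrite -[(2 ^ n).+2]/(1 + u) expnDn; apply: eq_bigr => i _.
  by rewrite exp1n mul1n.
rewrite E digit_sum_cat addnC mulnC divnMDl ?expn_gt0 ?u0 // divn_small ?digit_sum_lt // addn0.
by rewrite digit_sumS addn0 addnC mulnC modnMDl modn_small.
Qed.

Lemma dfun_bin f g : dfun f -> dfun g -> dfun (fun nu => 'C(f nu, g nu)).
Proof.
move=> Hf Hg; apply: (@dio_iff (fun nu => _ = _)).
  move=> nu; rewrite bin_digit; exact: iff_refl.
have H : dfun (fun nu => 2 ^ f nu) by apply: dfun_exp => //; apply: dfun_const.
have H1 := dfun_S H.
exact: (dfun_modn (dfun_divn (dfun_exp (dfun_S H1) Hf) (dfun_exp H1 Hg)) H1).
Qed.

(** Bitwise inclusion of the binary expansion of [x] in that of [y], as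
    [mask_bit] shows (theorem of Lucas modulo 2). *)
Definition mask x y := odd 'C(y, x).

Lemma dio_mask f g : dfun f -> dfun g -> dio (fun nu => mask (f nu) (g nu)).
Proof.
move=> Hf Hg; apply: (@dio_iff (fun nu => 'C(g nu, f nu) %% 2 = 1)).
  by move=> nu; rewrite modn2 /mask; case: (odd _).
by apply: dio_eq (dfun_const 1); apply: dfun_modn (dfun_const 2); apply: dfun_bin.
Qed.

Lemma odd_bin_double n m :
  odd 'C(n.*2, m.*2) = odd 'C(n, m) /\ odd 'C(n.*2, m.*2.+1) = false.
Proof.
elim: n m => [|n IH] m; first by rewrite double0 bin0n; case: m => //.
rewrite doubleS; split.
  case: m => [|m]; first by rewrite !bin0.
  rewrite doubleS !binS !oddD (proj2 (IH m)) (proj1 (IH m)) -doubleS (proj1 (IH m.+1)).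
  by do 2!case: odd.
rewrite !binS !oddD (proj2 (IH m)); case: m => [|m].
  by rewrite !bin0.
rewrite doubleS binS oddD -doubleS (proj1 (IH m.+1)) (proj2 (IH m)).
by do 2?case: odd.
Qed.

Lemma mask_bit m n (a b : bool) :
  mask (m.*2 + a) (n.*2 + b) = (a ==> b) && mask m n.
Proof.
rewrite /mask; have [H1 H2] := odd_bin_double n m.
case: a b => -[] /=; rewrite ?addn1 ?addn0 ?binS ?oddD ?H1 ?H2 //.
case: m {H1 H2} => [|m]; first by rewrite !bin0.
rewrite doubleS binS oddD -doubleS.
by rewrite (proj1 (odd_bin_double n m.+1)) (proj2 (odd_bin_double n m)) addbF.
Qed.

Lemma double_bit x : exists m (a : bool), x = m.*2 + a.
Proof. by exists x./2, (odd x); rewrite addnC odd_double_half. Qed.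

Lemma mask_digit h a b x y : a < 2 ^ h -> b < 2 ^ h ->
  mask (a + 2 ^ h * x) (b + 2 ^ h * y) = mask a b && mask x y.
Proof.
elim: h a b => [|h IH] a b.
  rewrite expn0 !ltnS !leqn0 => /eqP -> /eqP ->.
  by rewrite !add0n !mul1n [mask 0 0]/mask bin0.
have [m [i ->]] := double_bit a; have [n [j ->]] := double_bit b.
rewrite expnS => Ha Hb.
have E c (k : bool) z : c.*2 + k + 2 * 2 ^ h * z = (c + 2 ^ h * z).*2 + k.
  by rewrite -!muln2; lia.
rewrite !E !mask_bit IH ?andbA //; lia.
Qed.

Lemma mask_full h x : mask x (2 ^ h).-1 = (x < 2 ^ h).
Proof.
elim: h x => [|h IH] x; first by rewrite /mask bin0n; case: x.
have [m [a ->]] := double_bit x.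
have -> : (2 ^ h.+1).-1 = (2 ^ h).-1.*2 + true.
  rewrite expnS; have : 0 < 2 ^ h by rewrite expn_gt0.
  by move: (2 ^ h) => z; lia.
by rewrite mask_bit implybT /= IH expnS; move: (2 ^ h) => z; case: a; lia.
Qed.

Lemma mask0 x : mask x 0 = (x == 0).
Proof. by rewrite /mask bin0n; case: x. Qed.

Lemma mask_digit_sum h t f g : (forall i, i < t -> f i < 2 ^ h) -> (forall i, i < t -> g i < 2 ^ h) ->
  mask (digit_sum (2 ^ h) t f) (digit_sum (2 ^ h) t g) <-> forall i, i < t -> mask (f i) (g i).
Proof.
elim: t f g => [|t IH] f g Hf Hg; first by rewrite !digit_sum0; split=> // _; rewrite mask0.
rewrite !digit_sumS mask_digit ?Hf ?Hg //; split.
  case/andP=> M0 /IH M; case=> // i it; apply: M => // j jt; [exact: Hf|exact: Hg].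
move=> M; apply/andP; split; first exact: M.
by apply/IH => i it; [exact: Hf|exact: Hg|exact: M].
Qed.

(** * Reachability in affine transition systems *)

Lemma mask_leq x y : mask x y -> x <= y.
Proof. by rewrite /mask => H; rewrite leqNgt; apply/negP => L; rewrite bin_small in H. Qed.

Lemma mask_0l y : mask 0 y. Proof. by rewrite /mask bin0. Qed.

Lemma maskxx y : mask y y. Proof. by rewrite /mask binn. Qed.

Lemma mask_digit01 h j x : j <= 1 -> mask x ((2 ^ h).-1 * j) = (x <= (2 ^ h).-1 * j).
Proof.
case: j => [|[|//]] _; first by rewrite muln0 mask0 leqn0.
rewrite muln1 mask_full; have : 0 < 2 ^ h by rewrite expn_gt0.
by move: (2 ^ h) => z; lia.
Qed.

Definition digit Q x i := x %/ Q ^ i %% Q.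

Lemma digit_sum_digit Q t x : x < Q ^ t -> digit_sum Q t (digit Q x) = x.
Proof.
elim: t x => [|t IH] x; first by rewrite expn0 ltnS leqn0 => /eqP ->; rewrite digit_sum0.
have [-> |Q0] := posnP Q; first by rewrite exp0n.
rewrite expnS => xQ; rewrite digit_sumS /digit expn0 divn1.
rewrite [X in Q * X](_ : _ = x %/ Q); first by rewrite mulnC addnC -divn_eq.
rewrite -[RHS]IH ?ltn_divLR 1?mulnC //.
by apply: eq_digit_sum => i _; rewrite /digit expnS divnMA.
Qed.

(** The vector [z] has the coordinates 1, v0, v1, v2, v0', v1', v2' where v is the
    vector before the step and v' the vector after it. *)
Definition dot (a : seq nat) (z : nat -> nat) := \sum_(k < 7) nth 0 a k * z k.

Definition rule := seq (seq nat * seq nat).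

Definition obeys (r : rule) (z : nat -> nat) := all (fun e => dot e.1 z == dot e.2 z) r.

Lemma eq_dot a z z' : (forall k, k < 7 -> z k = z' k) -> dot a z = dot a z'.
Proof. by move=> E; apply: eq_bigr => k _; rewrite E. Qed.

Lemma eq_obeys r z z' : (forall k, k < 7 -> z k = z' k) -> obeys r z = obeys r z'.
Proof. by move=> E; apply: eq_all => e; rewrite !(eq_dot _ E). Qed.

Lemma dot_digit_sum a Q t (f : nat -> nat -> nat) :
  dot a (fun k => digit_sum Q t (f k)) = digit_sum Q t (fun i => dot a (fun k => f k i)).
Proof.
rewrite /dot /digit_sum; under eq_bigr => k _ do rewrite big_distrr /=.
rewrite exchange_big /=; apply: eq_bigr => i _.
by rewrite big_distrl /=; apply: eq_bigr => k _; rewrite mulnA.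
Qed.

(** The number [z k] packs the coordinate [k] of a sequence of transitions, one
    transition per digit; [z 0] is the indicator of the positions in use. The
    positions are distributed among the rules: [z1] takes those where the first
    rule applies, [z2] the others, and the masks state that a coordinate is 0
    at a position that is not in use. *)
Fixpoint history (H : nat) (rs : seq rule) (z : nat -> nat) : Prop :=
  if rs is r :: rs' then
    exists z1 z2 : nat -> nat,
      (forall k, k < 7 -> z k = z1 k + z2 k) /\ mask (z1 0) (z 0) /\
      (forall k, k < 7 -> mask (z1 k) (H.-1 * z1 0)) /\
      (forall k, k < 7 -> mask (z2 k) (H.-1 * z2 0)) /\
      obeys r z1 /\ history H rs' z2
  else forall k, k < 7 -> z k = 0.

Section Digits.
Variables (h kap t : nat).
Hypothesis h0 : 0 < h.
Let H := 2 ^ h.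
Let Q := 2 ^ (h + kap).

(** The row [f 0] is the indicator of the positions in use. *)
Definition sparse_digits (f : nat -> nat -> nat) :=
  forall i, i < t -> f 0 i <= 1 /\ forall k, k < 7 -> f k i <= H.-1 * f 0 i.

Lemma radix_bounds : 1 < H /\ H <= Q.
Proof. by rewrite /H /Q -{1}(expn0 2) ltn_exp2l // leq_exp2l // leq_addr. Qed.

Lemma sparse_lt f k i : sparse_digits f -> i < t -> k < 7 -> f k i < H.
Proof.
move=> G it k7; have [H1 HQ'] := radix_bounds; have [f0 /(_ k k7)] := G i it.
by move: H1; move: (f 0 i) f0 => [|[|//]] _; lia.
Qed.

Lemma sparse_lt_radix f k i : sparse_digits f -> i < t -> k < 7 -> f k i < Q.
Proof. by move=> G it k7; have [_] := radix_bounds; apply: leq_trans; apply: sparse_lt. Qed.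

Lemma sparse_mask f k : sparse_digits f -> k < 7 ->
  mask (digit_sum Q t (f k)) (H.-1 * digit_sum Q t (f 0)).
Proof.
move=> G k7; have [H1 HQ'] := radix_bounds; rewrite -digit_sumM; apply/mask_digit_sum.
- by move=> i it; apply: sparse_lt_radix.
- move=> i it; have [f0 _] := G i it.
  by apply: leq_trans HQ'; move: (f 0 i) f0 => [|[|//]] _; rewrite -/H; lia.
by move=> i it; have [f0 L] := G i it; rewrite mask_digit01 ?L.
Qed.

Lemma mask_sparse (z : nat -> nat) j :
  (forall i, i < t -> j i <= 1) -> z 0 = digit_sum Q t j ->
  (forall k, k < 7 -> mask (z k) (H.-1 * z 0)) ->
  sparse_digits (fun k => digit Q (z k)) /\ (forall i, i < t -> digit Q (z 0) i = j i)
  /\ forall k, k < 7 -> z k = digit_sum Q t (digit Q (z k)).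
Proof.
move=> Hj E0 M; have [H1 HQ'] := radix_bounds.
have Q0 : 0 < Q by lia.
have jQ i : i < t -> H.-1 * j i < Q.
  by move=> it; apply: leq_trans HQ'; move: (j i) (Hj i it) => [|[|//]] _; lia.
have E k : k < 7 -> z k = digit_sum Q t (digit Q (z k)).
  move=> k7; rewrite digit_sum_digit //; apply: leq_ltn_trans (mask_leq (M k k7)) _.
  by rewrite E0 -digit_sumM; apply: digit_sum_lt.
have Ej : forall i, i < t -> digit Q (z 0) i = j i.
  apply: (@digit_sum_inj Q).
  - by move=> i _; rewrite ltn_mod.
  - by move=> i it; have := Hj i it; lia.
  by rewrite -E.
split=> // i it; rewrite Ej //; split; first exact: Hj.
move=> k k7; move: (M k k7); rewrite {1}(E k k7) E0 -digit_sumM => /mask_digit_sum.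
rewrite -/Q => /(_ _ jQ) Mi; rewrite -mask_digit01 ?Hj //.
by apply: Mi => // i' _; rewrite ltn_mod.
Qed.

Definition coefs_bounded (rs : seq rule) := forall r e, r \in rs -> e \in r ->
  \sum_(k < 7) nth 0 e.1 k <= 2 ^ kap /\ \sum_(k < 7) nth 0 e.2 k <= 2 ^ kap.

Lemma dot_lt a f i : \sum_(k < 7) nth 0 a k <= 2 ^ kap -> sparse_digits f -> i < t ->
  dot a (fun k => f k i) < Q.
Proof.
move=> A G it; have [H1 _] := radix_bounds.
apply: (@leq_ltn_trans (2 ^ kap * H.-1)); last first.
  rewrite /Q expnD mulnC ltn_pmul2r ?expn_gt0 // -/H; lia.
apply: leq_trans (leq_mul A (leqnn _)); rewrite big_distrl /=.
apply: leq_sum => k _; rewrite leq_mul2l; apply/orP; right.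
by have := sparse_lt G it (ltn_ord k); lia.
Qed.

(** An equation between digit sums splits into equations between digits as long
    as nothing carries over; the factor [2 ^ kap] between the bound [H] of the
    digits and the radix [Q] leaves room for the linear combinations. *)
Lemma obeys_digit_sum rs r f : coefs_bounded rs -> r \in rs -> sparse_digits f ->
  obeys r (fun k => digit_sum Q t (f k)) <-> forall i, i < t -> obeys r (fun k => f k i).
Proof.
move=> S rrs G; split.
  move=> /allP A i it; apply/allP => e er; have [S1 S2] := S _ _ rrs er.
  have /eqP := A e er; rewrite !dot_digit_sum => E; apply/eqP.
  apply: (digit_sum_inj _ _ E) it => j jt; exact: dot_lt.
move=> A; apply/allP => e er; rewrite !dot_digit_sum; apply/eqP/eq_digit_sum => i it.
exact/eqP/(allP (A i it)).
Qed.

(** Both directions are inductions on the list of rules. For soundness, the digits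
    of [z] are the sums of those of [z1] and [z2] because no carry occurs, and at
    each position one of the two indicators vanishes. For completeness, [z1]
    collects the positions where the first rule holds. *)
Lemma historyP rs f z : coefs_bounded rs -> sparse_digits f ->
  (forall k, k < 7 -> z k = digit_sum Q t (f k)) ->
  history H rs z <-> forall i, i < t -> f 0 i = 1 ->
    exists2 r, r \in rs & obeys r (fun k => f k i).
Proof.
have [H1 HQ'] := radix_bounds.
elim: rs f z => [|r rs IH] f z S G E /=.
  split=> [Z i it fi|A k k7].
    have : f 0 i = 0; last by rewrite fi.
    apply: (@digit_sum_inj Q t (f 0) (fun=> 0)) it.
    - by move=> j jt; apply: sparse_lt_radix.
    - by move=> j jt; lia.
    by rewrite -E // Z // /digit_sum big1.
  rewrite E // /digit_sum big1 // => i _; have [f0 /(_ k k7)] := G i (ltn_ord i).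
  have [fi|fi] : f 0 i = 0 \/ f 0 i = 1 by lia.
    by rewrite fi muln0 leqn0 => /eqP ->.
  by have [] := A i (ltn_ord i) fi.
have S' : coefs_bounded rs by move=> r' e r'rs; apply: S; rewrite inE r'rs orbT.
split.
  move=> [z1 [z2 [Ez [M0 [M1 [M2 [Hr Hh]]]]]]].
  pose j1 := digit Q (z1 0).
  have Q0 : 0 < Q by lia.
  have E1 : z1 0 = digit_sum Q t j1.
    rewrite digit_sum_digit //; apply: leq_ltn_trans (mask_leq M0) _; rewrite E //.
    by apply: digit_sum_lt => i it; apply: sparse_lt_radix.
  have L1 i : i < t -> j1 i <= f 0 i.
    move: M0; rewrite E1 E // => /mask_digit_sum M it; apply: mask_leq; apply: M => // j jt.
      by rewrite ltn_mod.
    exact: sparse_lt_radix.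
  have L01 i : i < t -> j1 i <= 1 by move=> it; have [? _] := G i it; have := L1 i it; lia.
  have [G1 [_ F1]] := mask_sparse L01 E1 M1.
  have E2 : z2 0 = digit_sum Q t (fun i => f 0 i - j1 i).
    apply/eqP; rewrite -(eqn_add2l (z1 0)) -Ez // E // {1}E1 -digit_sumD; apply/eqP/eq_digit_sum => i it.
    by rewrite subnKC ?L1.
  have L2 i : i < t -> f 0 i - j1 i <= 1 by move=> it; have [? _] := G i it; lia.
  have [G2 [J2 F2]] := mask_sparse L2 E2 M2.
  have F k i : k < 7 -> i < t -> f k i = digit Q (z1 k) i + digit Q (z2 k) i.
    move=> k7; move: i.
    apply: (@digit_sum_inj Q t (f k) (fun i => digit Q (z1 k) i + digit Q (z2 k) i)).
    - by move=> i it; apply: sparse_lt_radix.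
    - move=> i it; have [f0 _] := G i it.
      have [_ /(_ k k7)] := G1 i it; have [_ /(_ k k7)] := G2 i it.
      rewrite J2 // -/j1; have := L1 i it; have := sparse_lt G2 it k7.
      have := sparse_lt G1 it k7.
      have [j0|j0] : j1 i = 0 \/ j1 i = 1 by have := L01 i it; lia.
        by rewrite j0; lia.
      by rewrite j0 (_ : f 0 i - 1 = 0); lia.
    by rewrite digit_sumD -F1 // -F2 // -E // Ez.
  have S1 : r \in r :: rs by rewrite mem_head.
  move=> i it fi; have [j0|j0] : j1 i = 0 \/ j1 i = 1 by have := L01 i it; lia.
    have [|r' r'rs Hr'] := (proj1 (IH _ _ S' G2 F2)) Hh i it; first by rewrite J2 // j0 fi.
    exists r'; first by rewrite inE r'rs orbT.
    rewrite (eq_obeys _ (z' := fun k => digit Q (z2 k) i)) // => k k7.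
    rewrite F // (_ : digit Q (z1 k) i = 0) //.
    by have [_ /(_ k k7)] := G1 i it; rewrite -/j1 j0; lia.
  exists r => //.
  have := proj1 (obeys_digit_sum S S1 G1) _ i it.
  rewrite (eq_obeys _ (z' := z1)); last by move=> k k7; rewrite -F1.
  move=> /(_ Hr); rewrite (eq_obeys _ (z' := fun k => f k i)) // => k k7.
  rewrite F // (_ : digit Q (z2 k) i = 0) ?addn0 //.
  by have [_ /(_ k k7)] := G2 i it; rewrite J2 // fi j0; lia.
move=> A; pose sel i := obeys r (fun k => f k i).
pose f1 k i := if sel i then f k i else 0; pose f2 k i := if sel i then 0 else f k i.
have G1 : sparse_digits f1.
  move=> i it; rewrite /f1; have [L0 L] := G i it.
  by case: (sel i); split=> // k k7; apply: L.
have G2 : sparse_digits f2.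
  move=> i it; rewrite /f2; have [L0 L] := G i it.
  by case: (sel i); split=> // k k7; apply: L.
exists (fun k => digit_sum Q t (f1 k)), (fun k => digit_sum Q t (f2 k)); split.
  move=> k k7; rewrite E // -digit_sumD; apply: eq_digit_sum => i _.
  by rewrite /f1 /f2; case: (sel i); rewrite ?addn0.
split.
  rewrite E //; apply/mask_digit_sum => [i it|i it|i it]; try exact: sparse_lt_radix.
  by rewrite /f1; case: (sel i); rewrite ?maskxx ?mask_0l.
split; first by move=> k k7; apply: sparse_mask.
split; first by move=> k k7; apply: sparse_mask.
split.
  apply/(obeys_digit_sum S _ G1); first by rewrite mem_head.
  move=> i it; rewrite /f1; case Ei: (sel i); first by [].
  by apply/allP => e _; rewrite /dot !big1 // => k _; rewrite muln0.
apply/(IH f2) => // i it; rewrite {1}/f2; case Ei: (sel i) => // fi.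
have [r' r'rs Hr'] := A i it fi.
exists r'; last by rewrite /f2 Ei.
by move: r'rs; rewrite inE => /predU1P[E'|//]; move: Ei; rewrite /sel -E' Hr'.
Qed.
End Digits.

Definition step_vector (v v' : nat -> nat) (k : nat) : nat :=
  if k is k'.+1 then (if k' < 3 then v k' else v' (k' - 3)) else 1.

Lemma step_vector_new v v' k : step_vector v v' k.+4 = v' k.
Proof.
have -> : step_vector v v' k.+4 = if k.+3 < 3 then v k.+3 else v' (k.+3 - 3) by [].
rewrite (_ : (k.+3 < 3) = false); last by lia.
by congr v'; lia.
Qed.

Definition affine_step (rs : seq rule) (v v' : nat -> nat) :=
  exists2 r, r \in rs & obeys r (step_vector v v').

Definition reach (rs : seq rule) (v v' : nat -> nat) :=
  exists t, exists w : nat -> nat -> nat,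
    (forall k, k < 3 -> w 0 k = v k) /\ (forall k, k < 3 -> w t k = v' k) /\
    forall i, i < t -> affine_step rs (w i) (w i.+1).

(** The run has [t] steps and the radix is [2 ^ (h + kap)]; the second equation makes
    [Z 0] the repunit with [t] digits, so that every position is in use. The
    number [Z k.+1] packs the coordinate [k] before each step and [Z k.+4] that
    after each step; they overlap, which is the equation relating [v] and [v']. *)
Definition reachsys kap (rs : seq rule) (v v' : nat -> nat) :=
  exists t h : nat, exists Z : nat -> nat,
    0 < h /\ 2 ^ (h + kap) * Z 0 + 1 = (2 ^ (h + kap)) ^ t + Z 0 /\
    (forall k, k < 7 -> mask (Z k) ((2 ^ h).-1 * Z 0)) /\
    (forall k, k < 3 -> v k < 2 ^ h /\ v' k < 2 ^ h /\
       Z k.+4 * 2 ^ (h + kap) + v k = Z k.+1 + v' k * (2 ^ (h + kap)) ^ t) /\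
    history (2 ^ h) rs Z.

Lemma repunit Q t : 0 < Q -> Q * digit_sum Q t (fun=> 1) + 1 = Q ^ t + digit_sum Q t (fun=> 1).
Proof.
move=> Q0; elim: t => [|t IH]; first by rewrite digit_sum0; lia.
rewrite digit_sumSr expnS; move: IH; move: (digit_sum _ _ _) (Q ^ t) => a b; lia.
Qed.

Lemma bounded_family t (w : nat -> nat -> nat) :
  exists2 h, 0 < h & forall i k, i <= t -> k < 3 -> w i k < 2 ^ h.
Proof.
exists (\sum_(i < t.+1) \sum_(k < 3) w i k).+1 => // i k it k3.
apply: leq_ltn_trans (ltn_expl _ (ltnSn 1)).
rewrite ltnW // ltnS (bigD1 (Ordinal (it : i < t.+1))) //=.
by rewrite (bigD1 (Ordinal k3)) //= -addnA leq_addr.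
Qed.

Lemma reachP kap rs v v' : coefs_bounded kap rs -> reach rs v v' <-> reachsys kap rs v v'.
Proof.
move=> S; split.
  move=> [t [w [W0 [Wt A]]]]; have [h h0 Hw] := bounded_family t w.
  pose f k i := step_vector (w i) (w i.+1) k.
  have [H1 HQ'] := radix_bounds kap h0.
  have G : sparse_digits h t f.
    move=> i it; split=> // k k7; rewrite muln1 /f /step_vector; case: k k7 => [|k] k7; first lia.
    case: ifP => k3; first by have := Hw i k (ltnW it) k3; lia.
    by have := Hw i.+1 (k - 3) it; lia.
  exists t, h, (fun k => digit_sum (2 ^ (h + kap)) t (f k)).
  split=> //; split; first by apply: repunit; rewrite expn_gt0.
  split; first by move=> k k7; apply: sparse_mask.
  split.
    move=> k k3; rewrite -W0 // -Wt //; split; first exact: Hw.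
    split; first exact: Hw.
    transitivity (digit_sum (2 ^ (h + kap)) t.+1 (fun i => w i k)).
      rewrite digit_sumS addnC mulnC; congr (_ + _ * _); apply: eq_digit_sum => i it.
      exact: step_vector_new.
    rewrite digit_sumSr; congr (_ + _); apply: eq_digit_sum => i it.
    by rewrite /f /= k3.
  apply/(historyP h0 S G) => // i it _; have [r rrs Hr] := A i it.
  by exists r.
move=> [t [h [Z [h0 [E0 [M [EV Hh]]]]]]].
have [H1 HQ'] := radix_bounds kap h0; set Q := 2 ^ (h + kap) in HQ' E0 EV.
have Z0 : Z 0 = digit_sum Q t (fun=> 1).
  have := @repunit Q t; rewrite expn_gt0 => /(_ isT).
  move: E0 HQ' H1; move: (Z 0) (digit_sum _ _ _) (Q ^ t) (2 ^ h) => a b c d; nia.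
have [G [J F]] := @mask_sparse h kap t h0 Z (fun=> 1) (fun _ _ => isT) Z0 M.
have A := proj1 (historyP h0 S G F) Hh.
pose f k := digit Q (Z k).
have dgQ x i : digit Q x i < Q by rewrite ltn_mod; lia.
pose w i k := if i is i'.+1 then f k.+4 i' else v k.
have Ew k : k < 3 -> forall i, i < t.+1 -> w i k = if i < t then f k.+1 i else v' k.
  move=> k3; have [vk [v'k E]] := EV k k3.
  apply: (@digit_sum_inj Q).
  - case=> [|i] it /=; first lia.
    exact: dgQ.
  - move=> i it; case: ifP => ti; last lia.
    exact: dgQ.
  transitivity (Z k.+4 * Q + v k).
    by rewrite digit_sumS addnC mulnC [in RHS](F k.+4 ltac:(lia)).
  rewrite E {1}(F k.+1 ltac:(lia)) digit_sumSr ltnn; congr (_ + _).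
  by apply: eq_digit_sum => i ->.
exists t, w; split; first by [].
split; first by move=> k k3; rewrite Ew // ltnn.
move=> i it; have [|r rrs Hr] := A i it; first by rewrite J.
exists r => //; rewrite -(eq_obeys _ (z := fun k => f k i)) // => k k7.
rewrite /step_vector; case: k k7 => [|k] k7; first exact: J.
case: ifP => k3; first by rewrite Ew ?it // ltnW.
by rewrite /w /f; congr (digit _ (Z _) _); lia.
Qed.

Lemma dfun_sum n (f : nat -> env -> nat) : (forall k, dfun (f k)) ->
  dfun (fun nu => \sum_(k < n) f k nu).
Proof.
move=> Hf; elim: n => [|n IH].
  apply: (@dio_iff (fun nu => nu 0 = 0)); last by dio_auto.
  by move=> nu; rewrite big_ord0.
apply: (@dio_iff (fun nu => nu 0 =
   \sum_(k < n) f k (fun i => nu i.+1) + f n (fun i => nu i.+1))).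
  by move=> nu; rewrite big_ord_recr.
exact: (dfun_add IH (Hf n)).
Qed.

Lemma dio_all n (R : nat -> env -> Prop) : (forall k, dio (R k)) ->
  dio (fun nu => forall k, k < n -> R k nu).
Proof.
move=> HR; elim: n => [|n IH]; first by apply: dio_iff dio_True.
apply: dio_iff (dio_and (HR n) IH) => nu; split.
  by move=> [Hn H] k; rewrite ltnS leq_eqVlt => /predU1P[->//|/H].
by move=> H; split=> [|k kn]; apply: H => //; apply: ltnW.
Qed.

Lemma dfun_dot a (z : nat -> env -> nat) : (forall k, dfun (z k)) ->
  dfun (fun nu => dot a (fun k => z k nu)).
Proof.
move=> Hz; apply: (@dfun_sum 7 (fun k nu => nth 0 a k * z k nu)) => k.
by apply: dfun_mul; [apply: dfun_const|].
Qed.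

Lemma dio_obeys r (z : nat -> env -> nat) : (forall k, dfun (z k)) ->
  dio (fun nu => obeys r (fun k => z k nu)).
Proof.
move=> Hz; elim: r => [|e r IH]; first by apply: dio_iff dio_True.
apply: (@dio_iff (fun nu => dot e.1 (fun k => z k nu) = dot e.2 (fun k => z k nu) /\
   obeys r (fun k => z k nu))).
  by move=> nu; rewrite /obeys /=; split=> [[/eqP -> ->]//|/andP[/eqP]].
by apply: dio_and IH; apply: dio_eq; apply: dfun_dot.
Qed.

Lemma dfun_pred f : dfun f -> dfun (fun nu => (f nu).-1).
Proof.
move=> Hf; apply: (@dio_iff (fun nu => (f (fun i => nu i.+1) = 0 /\ nu 0 = 0) \/
   f (fun i => nu i.+1) = (nu 0).+1)).
  by move=> nu; case: (f _) => [|x]; split; lia.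
by have H := dfun_rename S Hf; dio_auto.
Qed.

Lemma dio_history rs : dio (fun nu => history (nu 0) rs (fun k => nu k.+1)).
Proof.
elim: rs => [|r rs IH] /=; first by apply: dio_all => k; dio_auto.
have M f g h : dfun f -> dfun g -> dfun h -> dio (fun nu => mask (f nu) ((g nu).-1 * h nu)).
  by move=> Hf Hg Hh; apply: dio_mask => //; apply: dfun_mul => //; apply: dfun_pred.
apply: dio_exists_fun; apply: dio_exists_fun.
apply: dio_and; first by apply: dio_all => k; dio_auto.
apply: dio_and; first by apply: dio_mask; dio_auto.
apply: dio_and; first by apply: dio_all => k; apply: M; dio_auto.
apply: dio_and; first by apply: dio_all => k; apply: M; dio_auto.
apply: dio_and; first by apply: (dio_obeys r (z := fun k nu => nu _)) => k; dio_auto.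
exact: (dio_rename (fun i => if i is k.+1 then k.*2 else 3) IH).
Qed.

Lemma coef_bound (rs : seq rule) : exists kap, coefs_bounded kap rs.
Proof.
pose c (e : seq nat * seq nat) :=
  \sum_(k < 7) nth 0 e.1 k + \sum_(k < 7) nth 0 e.2 k.
exists (\sum_(r <- rs) \sum_(e <- r) c e) => r e rrs er.
suff H : c e <= 2 ^ (\sum_(r <- rs) \sum_(e <- r) c e).
  by split; apply: leq_trans H; rewrite ?leq_addr ?leq_addl.
apply: leq_trans (ltnW (ltn_expl _ (ltnSn 1))).
by rewrite (big_rem r) //= (big_rem e) //= -addnA leq_addr.
Qed.

(** The central fact about computations: the runs of a finitely presented affine
    transition system are Diophantine. *)
Lemma dio_reach rs (v v' : nat -> env -> nat) :
  (forall k, dfun (v k)) -> (forall k, dfun (v' k)) ->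
  dio (fun nu => reach rs (fun k => v k nu) (fun k => v' k nu)).
Proof.
move=> Hv Hv'; have [kap S] := coef_bound rs.
apply: dio_iff; first by move=> nu; apply: iff_sym; apply: reachP S.
rewrite /reachsys; do 2!(apply: dio_exists; cbv beta); apply: dio_exists_fun.
have P g : dfun g -> dfun (fun nu => 2 ^ g nu).
  by apply: dfun_exp; apply: dfun_const.
have PQ : dfun (fun nu => 2 ^ (nu 1 + kap)) by apply: P; dio_auto.
apply: dio_and; first by dio_auto.
apply: dio_and.
  by apply: dio_eq; repeat first [assumption | apply: P | apply: dfun_exp | dio_step].
apply: dio_and.
  apply: dio_all => k; apply: dio_mask; first by dio_auto.
  by apply: dfun_mul; [apply: dfun_pred; apply: P|]; dio_auto.
apply: dio_and.
  apply: dio_all => k.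
  have Hvk := dfun_rename (fun i => i.+2.*2.+1) (Hv k).
  have Hvk' := dfun_rename (fun i => i.+2.*2.+1) (Hv' k).
  by repeat first [assumption | apply: P | apply: dfun_exp | dio_step].
apply: (@dio_comp (fun x nu => history x rs (fun k => nu k.*2))); last by apply: P; dio_auto.
exact: (dio_rename (fun i => if i is k.+1 then k.*2.+1 else 0) (dio_history rs)).
Qed.

(** * Turing machines as affine transition systems *)

Lemma dotE a z : dot a z = nth 0 a 0 * z 0 + nth 0 a 1 * z 1 + nth 0 a 2 * z 2 +
  nth 0 a 3 * z 3 + nth 0 a 4 * z 4 + nth 0 a 5 * z 5 + nth 0 a 6 * z 6.
Proof. by rewrite /dot !big_ord_recr big_ord0 /= add0n. Qed.

Definition eq3 (v w : nat -> nat) := forall k, k < 3 -> v k = w k.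

Lemma eq3P v w : eq3 v w <-> v 0 = w 0 /\ v 1 = w 1 /\ v 2 = w 2.
Proof.
split=> [E|[E0 [E1 E2]]]; first by rewrite !E.
by case=> [|[|[|k]]].
Qed.

Lemma eq_affine_step rs v v' w w' : eq3 v w -> eq3 v' w' -> affine_step rs v v' -> affine_step rs w w'.
Proof.
move=> E E' [r rrs H]; exists r => //; rewrite -(eq_obeys _ (z := step_vector v v')) //.
by case=> [|k] k7 //; rewrite /step_vector; case: ifP => [/E //|k3]; apply: E'; lia.
Qed.

Lemma reach_refl rs v v' : eq3 v v' -> reach rs v v'.
Proof. by move=> E; exists 0, (fun=> v). Qed.

Lemma reach_cons rs v u v' : affine_step rs v u -> reach rs u v' -> reach rs v v'.
Proof.
move=> S [t [w [W0 [Wt A]]]].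
exists t.+1, (fun i => if i is j.+1 then w j else v); split=> //; split=> //.
case=> [|i] it; last exact: A.
by apply: eq_affine_step S => // k k3; rewrite W0.
Qed.

Lemma reach_inv rs v v' : reach rs v v' ->
  eq3 v v' \/ exists2 u, affine_step rs v u & reach rs u v'.
Proof.
move=> [[|t] [w [W0 [Wt A]]]]; [left => k k3 | right].
  by rewrite -W0 // Wt.
exists (w 1); first by apply: eq_affine_step (A 0 _).
by exists t, (fun i => w i.+1); split=> //; split=> // i it; apply: A.
Qed.

Section Machine.
Variables (A : finType) (M : turing_machine A).
Notation sym := (option (A + aux M)).

Definition base := #|{: (A + aux M)%type}|.+1.
(** The blank gets the digit 0, so that the number of a stack is insensitive to
    the blanks at its bottom. *)
Definition symbol_number (s : sym) : nat := if s is Some x then (enum_rank x).+1 else 0.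

Lemma symbol_number_lt s : symbol_number s < base.
Proof. by case: s => [x|] //=; rewrite /base ltnS. Qed.

Lemma symbol_number_inj : injective symbol_number.
Proof. by case=> [x|] [y|] //= [/ord_inj/enum_rank_inj ->]. Qed.

Definition stack_number (l : seq sym) := foldr (fun s x => symbol_number s + base * x) 0 l.

Lemma stack_number_head l : stack_number l = symbol_number (head None l) + base * stack_number (behead l).
Proof. by case: l => //=; rewrite muln0. Qed.

Lemma stack_number_inj s s' x x' :
  symbol_number s + base * x = symbol_number s' + base * x' -> s = s' /\ x = x'.
Proof.
move=> E; have E0 : symbol_number s = symbol_number s'.
  have := congr1 (modn^~ base) E.
  by rewrite !(addnC (symbol_number _)) !(mulnC base) !modnMDl !modn_small ?symbol_number_lt.
split; first exact: symbol_number_inj.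
by apply/eqP; rewrite -(eqn_pmul2l (isT : 0 < base)); apply/eqP; lia.
Qed.

(** The numbers 0 and 1 are kept for the vectors that end and begin a run. *)
Definition control_number (q : state M) (s : sym) : nat := (symbol_number s + base * enum_rank q).+2.

Lemma control_number_inj q s q' s' : control_number q s = control_number q' s' -> q = q' /\ s = s'.
Proof. by move=> [/stack_number_inj[-> /ord_inj/enum_rank_inj ->]]. Qed.

Definition config_vector (c : config M) (k : nat) : nat :=
  match k with
  | 0 => control_number (control c) (scanned c) | 1 => stack_number (lefts c) | _ => stack_number (rights c)
  end.

(** The symbol [s2] uncovered by the move is guessed; the equation that pops it
    determines it, since it is a digit. *)
Definition move_rule (q : state M) (s : sym) q' (s' : sym) (d : direction) (s2 : sym)
    : rule :=
  match d with
  | MoveRight =>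
    [:: ([:: 0; 1], [:: control_number q s]); ([:: 0; 0; 0; 0; 1], [:: control_number q' s2]);
        ([:: 0; 0; 0; 0; 0; 1], [:: symbol_number s'; 0; base]);
        ([:: 0; 0; 0; 1], [:: symbol_number s2; 0; 0; 0; 0; 0; base])]
  | MoveLeft =>
    [:: ([:: 0; 1], [:: control_number q s]); ([:: 0; 0; 0; 0; 1], [:: control_number q' s2]);
        ([:: 0; 0; 0; 0; 0; 0; 1], [:: symbol_number s'; 0; 0; base]);
        ([:: 0; 0; 1], [:: symbol_number s2; 0; 0; 0; 0; base])]
  | Stay =>
    [:: ([:: 0; 1], [:: control_number q s]); ([:: 0; 0; 0; 0; 1], [:: control_number q' s']);
        ([:: 0; 0; 0; 0; 0; 1], [:: 0; 0; 1]);
        ([:: 0; 0; 0; 0; 0; 0; 1], [:: 0; 0; 0; 1])]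
  end.

Definition final_rule (q : state M) (s : sym) : rule :=
  [:: ([:: 0; 1], [:: control_number q s]); ([:: 0; 0; 0; 0; 1], [::]);
      ([:: 0; 0; 0; 0; 0; 1], [::]); ([:: 0; 0; 0; 0; 0; 0; 1], [::])].

(** Reads the first symbol of the input, which is stored in the coordinate 2. *)
Definition init_rule (s : sym) : rule :=
  [:: ([:: 0; 1], [:: 1]); ([:: 0; 0; 0; 0; 1], [:: control_number (start M) s]);
      ([:: 0; 0; 0; 0; 0; 1], [:: 0; 0; 1]);
      ([:: 0; 0; 0; 1], [:: symbol_number s; 0; 0; 0; 0; 0; base])].

Definition local_rules (q : state M) (s s2 : sym) : seq rule :=
  match trans q s with
  | Some (q', s', d) => [:: move_rule q s q' s' d s2]
  | None => if accepting q then [::] else [:: final_rule q s]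
  end.

Definition rules : seq rule :=
  [seq init_rule s | s <- enum {: sym}] ++
  flatten [seq local_rules x.1.1 x.1.2 x.2 | x <- enum {: state M * sym * sym}].

Lemma rulesP r : r \in rules <->
  (exists s, r = init_rule s) \/ exists q s s2, r \in local_rules q s s2.
Proof.
rewrite mem_cat; split.
  case/orP=> [/mapP[s _ ->]|/flatten_mapP[[[q s] s2] _ H]]; first by left; exists s.
  by right; exists q, s, s2.
case=> [[s ->]|[q [s [s2 H]]]]; apply/orP; [left|right].
  by rewrite map_f // mem_enum.
by apply/flatten_mapP; exists (q, s, s2); rewrite // mem_enum.
Qed.

Let sub3 : (3 - 3 = 0) * (4 - 3 = 1) * (5 - 3 = 2). Proof. by []. Qed.
Ltac rule_eqs := rewrite /obeys /= !dotE /= ?sub3 ?andbT.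

Lemma init_ruleP s v v' : obeys (init_rule s) (step_vector v v') <->
  v 0 = 1 /\ v' 0 = control_number (start M) s /\ v' 1 = v 1 /\ v 2 = symbol_number s + base * v' 2.
Proof.
rule_eqs; split; first by case/and4P; lia.
by move=> [? [? [? ?]]]; apply/and4P; split; lia.
Qed.

Lemma final_ruleP q s v v' : obeys (final_rule q s) (step_vector v v') <->
  v 0 = control_number q s /\ eq3 v' (fun=> 0).
Proof.
rewrite eq3P; rule_eqs; split; first by case/and4P; lia.
by move=> [? [? [? ?]]]; apply/and4P; split; lia.
Qed.

Lemma move_ruleP q s q' s' d s2 v v' : obeys (move_rule q s q' s' d s2) (step_vector v v') <->
  v 0 = control_number q s /\
  match d with
  | MoveRight => v' 0 = control_number q' s2 /\ v' 1 = symbol_number s' + base * v 1 /\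
                 v 2 = symbol_number s2 + base * v' 2
  | MoveLeft => v' 0 = control_number q' s2 /\ v' 2 = symbol_number s' + base * v 2 /\
                v 1 = symbol_number s2 + base * v' 1
  | Stay => v' 0 = control_number q' s' /\ v' 1 = v 1 /\ v' 2 = v 2
  end.
Proof.
case: d; rule_eqs; (split; first by case/and4P; lia).
all: by move=> [? [? [? ?]]]; apply/and4P; split; lia.
Qed.

Lemma astep_config c v' : affine_step rules (config_vector c) v' <->
  if halted c then ~~ accepting (control c) /\ eq3 v' (fun=> 0) else eq3 v' (config_vector (step c)).
Proof.
case: c => q l s r; split.
  case=> r0 /rulesP[[s1 ->]|[q1 [s1 [s2]]]].
    by case/init_ruleP.
  rewrite /local_rules /halted /step /=.
  case E: (trans q1 s1) => [[[q' s'] d]|]; last first.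
    case: ifP => // Ha; rewrite inE => /eqP -> /final_ruleP[/= /control_number_inj[-> ->] Z].
    by rewrite E /= Ha.
  rewrite inE => /eqP -> /move_ruleP[/= /control_number_inj[-> ->]]; rewrite E /= eq3P.
  case: d {E} => /=.
  - by move=> [-> [-> ]]; rewrite stack_number_head => /stack_number_inj[-> ->].
  - by [].
  by move=> [-> [-> ]]; rewrite stack_number_head => /stack_number_inj[-> ->].
rewrite /halted /step /=; case E: (trans q s) => [[[q' s'] d]|] /=.
  rewrite eq3P => V.
  pose s2 := match d with MoveLeft => head None l | _ => head None r end.
  exists (move_rule q s q' s' d s2).
    by apply/rulesP; right; exists q, s, s2; rewrite /local_rules E mem_head.
  apply/move_ruleP; split=> //; rewrite /s2.
  case: d V {s2 E} => /= -[V0 [V1 V2]]; rewrite V0 ?V1 ?V2; split=> //; split=> //.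
    exact: stack_number_head.
  exact: stack_number_head.
move=> [Ha Z]; exists (final_rule q s); last by apply/final_ruleP.
by apply/rulesP; right; exists q, s, s; rewrite /local_rules E (negbTE Ha) mem_head.
Qed.

Lemma reach_config c : reach rules (config_vector c) (fun=> 0) <->
  exists t, let c' := iter t (@step A M) c in halted c' /\ accepting (control c') = false.
Proof.
split.
  case=> n; elim: n c => [|n IH] c [w [W0 [Wt P]]]; first by have := W0 0 isT; rewrite Wt.
  have /astep_config : affine_step rules (config_vector c) (w 1) by apply: eq_affine_step (P 0 _).
  case: ifP => [Hc [Ha _]|Hc E]; first by exists 0; split=> //; apply/negbTE.
  have [|t [Ht At]] := IH (step c); last by exists t.+1; rewrite iterSr.
  exists (fun i => w i.+1); split; first exact: E.
  by split=> // i it; apply: P.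
case=> t; elim: t c => [|t IH] c /=.
  move=> [Hc Ha]; apply: (@reach_cons _ _ (fun=> 0)); last exact: reach_refl.
  by apply/astep_config; rewrite Hc Ha.
rewrite -/(iter t.+1 _ _) iterSr => /IH H.
have [Hc|Hc] := boolP (halted c).
  by move: H; rewrite /step; move: Hc; rewrite /halted; case: (trans _ _).
apply: reach_cons H; apply/astep_config; rewrite (negbTE Hc) //.
Qed.

Definition tape (w : seq A) := stack_number [seq Some (inl a) | a <- w].

Lemma reach_rejects w :
  reach rules (fun k => nth 0 [:: 1; 0; tape w] k) (fun=> 0) <-> halts_with M w false.
Proof.
pose v0 := fun k => nth 0 [:: 1; 0; tape w] k.
have init_step u : affine_step rules v0 u <-> eq3 u (config_vector (init M w)).
  rewrite eq3P; split.
    case=> r /rulesP[[s ->]|[q [s [s2]]]].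
      move=> /init_ruleP[_ [-> [-> ]]]; rewrite -[v0 2]/(tape w) /tape stack_number_head.
      by move=> /stack_number_inj[<- <-].
    rewrite /local_rules; case: (trans q s) => [[[q' s'] d]|].
      by rewrite inE => /eqP -> /move_ruleP[].
    by case: ifP => // _; rewrite inE => /eqP -> /final_ruleP[].
  move=> [E0 [E1 E2]]; exists (init_rule (scanned (init M w))).
    by apply/rulesP; left; eexists.
  by apply/init_ruleP; split=> //; split=> //; split=> //; rewrite E2; apply: stack_number_head.
split.
  case/reach_inv; first by move=> /(_ 0 isT).
  case=> u /init_step E [n [f [F0 [Fn P]]]]; apply/reach_config; exists n, f; split=> //.
  by move=> k k3; rewrite F0 // E.
by move/reach_config => H; apply: reach_cons H; apply/init_step.
Qed.
End Machine.

Lemma halts_with_det A (M : turing_machine A) w b b' :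
  halts_with M w b -> halts_with M w b' -> b = b'.
Proof.
have fix_step c n : halted c -> iter n (@step A M) c = c.
  move=> Hc; elim: n => //= n ->; move: Hc; rewrite /halted /step.
  by case: (trans _ _).
have aux t t' b1 b2 : t <= t' ->
    halted (iter t (@step A M) (init M w)) /\
    accepting (control (iter t (@step A M) (init M w))) = b1 ->
    halted (iter t' (@step A M) (init M w)) /\
    accepting (control (iter t' (@step A M) (init M w))) = b2 -> b1 = b2.
  move=> /subnK <-; rewrite iterD => -[H <-]; rewrite fix_step // => -[_ <-] //.
move=> [t Ht] [t' Ht']; have [tt'|/ltnW tt'] := leqP t t'; first exact: aux Ht Ht'.
by apply/esym; apply: aux Ht' Ht.
Qed.

Section Rejects.
Variable M : turing_machine bool.
Let b := base M.
Let T := symbol_number (Some (inl true) : option (bool + aux M)).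
Let F := symbol_number (Some (inl false) : option (bool + aux M)).

(** The tape number of a unary block [1 ^ a 0] followed by a tape of number [x];
    the quotient is the repunit with [a] digits. *)
Definition block (a x : nat) := T * ((b ^ a).-1 %/ b.-1) + b ^ a * (F + b * x).

Lemma base_gt1 : 1 < b.
Proof.
by rewrite /b /base ltnS; apply/card_gt0P; exists (inl true).
Qed.

Lemma tape_block a w : tape M (rcons (nseq a true) false ++ w) = block a (tape M w).
Proof.
have G c : (b ^ c).-1 %/ b.-1 = digit_sum b c (fun=> 1).
  rewrite predn_exp mulKn; last by have := base_gt1; lia.
  by apply: eq_bigr => i _; rewrite mul1n.
rewrite /block G; elim: a => [|a IH]; first by rewrite digit_sum0 muln0 mul1n.
rewrite (_ : tape M _ = T + b * tape M (rcons (nseq a true) false ++ w)) // IH.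
by rewrite digit_sumS expnS; ring.
Qed.

Definition tape_of (l : seq nat) (x : nat) := foldr block x l.

Lemma tape_unary l w : tape M (unary l ++ w) = tape_of l (tape M w).
Proof.
rewrite /unary; elim: l => //= a l IH.
by rewrite -catA tape_block IH.
Qed.

Lemma dfun_block f g : dfun f -> dfun g -> dfun (fun nu => block (f nu) (g nu)).
Proof.
move=> Hf Hg; have P : dfun (fun nu => b ^ f nu) by apply: dfun_exp => //; apply: dfun_const.
rewrite /block; repeat first [assumption | apply: dfun_divn | apply: dfun_pred | dio_step].
Qed.

Lemma dfun_tape_of (l : seq (env -> nat)) g : (forall f, List.In f l -> dfun f) -> dfun g ->
  dfun (fun nu => tape_of [seq f nu | f <- l] (g nu)).
Proof.
move=> Hl Hg; elim: l Hl => [|f l IH] Hl //=.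
by apply: dfun_block; [apply: Hl; left|apply: IH => f' Hf'; apply: Hl; right].
Qed.

Definition rejects (l : seq nat) (x : nat) :=
  reach (rules M) (fun k => nth 0 [:: 1; 0; tape_of l x] k) (fun=> 0).

Lemma rejectsP l w : rejects l (tape M w) <-> halts_with M (unary l ++ w) false.
Proof. by rewrite /rejects -tape_unary reach_rejects. Qed.

Lemma dio_rejects (l : seq (env -> nat)) g : (forall f, List.In f l -> dfun f) -> dfun g ->
  dio (fun nu => rejects [seq f nu | f <- l] (g nu)).
Proof.
move=> Hl Hg; have H := dfun_tape_of Hl Hg.
apply: (@dio_reach (rules M) (fun k nu => nth 0 [:: 1; 0; tape_of [seq f nu | f <- l] (g nu)] k)
  (fun k nu => 0)); last by move=> k; apply: dfun_const.
case=> [|[|[|k]]] //=; try exact: dfun_const.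
Qed.
End Rejects.



(** * Sums of four squares *)

Section FourSquares.
Local Open Scope ring_scope.

Definition sum4 (n : int) :=
  exists a b c d : int, n = a ^+ 2 + b ^+ 2 + c ^+ 2 + d ^+ 2.

(** Euler's identity, the multiplicativity of the norm of quaternions. *)
Lemma sum4M m n : sum4 m -> sum4 n -> sum4 (m * n).
Proof.
move=> [a [b [c [d ->]]]] [a' [b' [c' [d' ->]]]].
exists (a * a' + b * b' + c * c' + d * d'), (a * b' - b * a' + c * d' - d * c').
exists (a * c' - b * d' - c * a' + d * b'), (a * d' + b * c' - c * b' - d * a').
ring.
Qed.

Lemma balanced_residue (m a : int) : 0 < m ->
  exists k r, a = m * k + r /\ - m <= 2 * r <= m.
Proof.
move=> m0; have E := divz_eq a m; have L := ltz_pmod a m0; have G := modz_ge0 a (lt0r_neq0 m0).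
move: E L G; move: (a %/ m)%Z (a %% m)%Z => k r E L G.
have [H|H] := lerP (2 * r) m.
  by exists k, r; split; [rewrite E; ring|lia].
by exists (k + 1), (r - m); split; [rewrite E; ring|lia].
Qed.

Lemma residue_sq (m x : int) : - m <= 2 * x <= m -> 4 * x ^+ 2 <= m ^+ 2.
Proof.
move=> /andP[L U]; have : 0 <= (m - 2 * x) * (m + 2 * x) by apply: mulr_ge0; lra.
lra.
Qed.

Lemma residue_half (m x : int) : 4 * x ^+ 2 = m ^+ 2 -> exists e, 2 * x = e * m.
Proof.
move=> Ex; have : (2 * x - m) * (2 * x + m) = 0 by lra.
by move/eqP; rewrite mulf_eq0 => /orP[]/eqP H; [exists 1|exists (-1)]; lra.
Qed.

(** Multiply the representation of [m * p] by that of the residues modulo [m],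
    which represents [m * r] with [r <= m]: the four sums given by Euler's identity
    are divisible by [m]. In the extreme cases [r = 0] and [r = m] all residues are
    0 or half of [m] and [m] divides [p]. *)
Lemma sum4_descent (p m : int) : 0 < m -> m < p -> sum4 (m * p) ->
  (forall k, p = m * k -> m = 1) ->
  m = 1 \/ exists r, [/\ 0 < r, r < m & sum4 (r * p)].
Proof.
move=> m0 mp [a [b [c [d E]]]] P.
have [k1 [a' [Ea Ba]]] := balanced_residue a m0.
have [k2 [b' [Eb Bb]]] := balanced_residue b m0.
have [k3 [c' [Ec Bc]]] := balanced_residue c m0.
have [k4 [d' [Ed Bd]]] := balanced_residue d m0.
pose r := p - m * (k1 ^+ 2 + k2 ^+ 2 + k3 ^+ 2 + k4 ^+ 2)
   - 2 * (k1 * a' + k2 * b' + k3 * c' + k4 * d').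
have Er : m * r = a' ^+ 2 + b' ^+ 2 + c' ^+ 2 + d' ^+ 2.
  rewrite /r !mulrBr E Ea Eb Ec Ed; ring.
have sq := @residue_sq m.
have sq0 x : 0 <= x ^+ 2 :> int by exact: sqr_ge0.
have r0 : 0 <= r by rewrite -(pmulr_rge0 _ m0) Er !addr_ge0.
have rm : r <= m.
  rewrite -(ler_pM2l m0) Er -expr2.
  have := sq _ Ba; have := sq _ Bb; have := sq _ Bc; have := sq _ Bd.
  by move: (a' ^+ 2) (b' ^+ 2) (c' ^+ 2) (d' ^+ 2) (m ^+ 2) => *; lra.
have [rz|rz] := eqVneq r 0.
  left; apply: (P (k1 ^+ 2 + k2 ^+ 2 + k3 ^+ 2 + k4 ^+ 2)).
  have Z x : x ^+ 2 = 0 -> x = 0 :> int by move/eqP; rewrite sqrf_eq0 => /eqP.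
  have : a' ^+ 2 = 0 /\ b' ^+ 2 = 0 /\ c' ^+ 2 = 0 /\ d' ^+ 2 = 0.
    move: Er (sq0 a') (sq0 b') (sq0 c') (sq0 d'); rewrite rz mulr0.
    by move: (a' ^+ 2) (b' ^+ 2) (c' ^+ 2) (d' ^+ 2) => *; do !split; lra.
  move=> [/Z Za [/Z Zb [/Z Zc /Z Zd]]].
  by move: rz; rewrite /r Za Zb Zc Zd; lra.
have [rm'|rm'] := eqVneq r m; last first.
  right; exists r; split; [lia|lia|].
  pose x1 := r + (k1 * a' + k2 * b' + k3 * c' + k4 * d').
  pose x2 := k1 * b' - k2 * a' + k3 * d' - k4 * c'.
  pose x3 := k1 * c' - k2 * d' - k3 * a' + k4 * b'.
  pose x4 := k1 * d' + k2 * c' - k3 * b' - k4 * a'.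
  have X1 : m * x1 = a * a' + b * b' + c * c' + d * d'.
    by rewrite /x1 mulrDr Er Ea Eb Ec Ed; ring.
  have X2 : m * x2 = a * b' - b * a' + c * d' - d * c' by rewrite /x2 Ea Eb Ec Ed; ring.
  have X3 : m * x3 = a * c' - b * d' - c * a' + d * b' by rewrite /x3 Ea Eb Ec Ed; ring.
  have X4 : m * x4 = a * d' + b * c' - c * b' - d * a' by rewrite /x4 Ea Eb Ec Ed; ring.
  exists x1, x2, x3, x4; apply: (@mulfI _ (m ^+ 2)); first by rewrite expf_neq0 // gt_eqF.
  transitivity ((m * p) * (m * r)); first by ring.
  transitivity ((m * x1) ^+ 2 + (m * x2) ^+ 2 + (m * x3) ^+ 2 + (m * x4) ^+ 2).
    by rewrite X1 X2 X3 X4 E Er; ring.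
  by ring.
have half := @residue_half m.
have : 4 * a' ^+ 2 = m ^+ 2 /\ 4 * b' ^+ 2 = m ^+ 2 /\ 4 * c' ^+ 2 = m ^+ 2 /\ 4 * d' ^+ 2 = m ^+ 2.
  have := sq _ Ba; have := sq _ Bb; have := sq _ Bc; have := sq _ Bd.
  move: Er; rewrite rm' -expr2.
  move: (a' ^+ 2) (b' ^+ 2) (c' ^+ 2) (d' ^+ 2) (m ^+ 2) => *; do !split; lra.
move=> [/half[e1 H1] [/half[e2 H2] [/half[e3 H3] /half[e4 H4]]]].
left; apply: (P (k1 ^+ 2 + k2 ^+ 2 + k3 ^+ 2 + k4 ^+ 2 + k1 * e1 + k2 * e2 + k3 * e3 + k4 * e4 + 1)).
have -> : p = r + m * (k1 ^+ 2 + k2 ^+ 2 + k3 ^+ 2 + k4 ^+ 2) +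
   (k1 * (2 * a') + k2 * (2 * b') + k3 * (2 * c') + k4 * (2 * d')) by rewrite /r; ring.
by rewrite rm' H1 H2 H3 H4; ring.
Qed.

(** The [p./2 + 1] squares and the [p./2 + 1] numbers [-1 - a ^ 2] cannot be disjoint
    modulo [p]. *)
Lemma minus_one_sum2 p : prime p -> odd p ->
  exists a b m : nat, [/\ (a ^ 2 + b ^ 2 + 1 = m * p)%N, (0 < m)%N & (m < p)%N].
Proof.
move=> pp op; set h := p./2; have p_gt1 := prime_gt1 pp.
have Ep : p = (h + h).+1 by rewrite -[LHS]odd_double_half op addnn.
have p0 : (0 < p)%N by lia.
have inj_sq (a b : nat) : (a <= h)%N -> (b <= h)%N -> (a ^ 2 = b ^ 2 %[mod p])%N -> a = b.
  wlog ab : a b / (a <= b)%N => [W ah bh E|ah bh /esym/eqP].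
    by case/orP: (leq_total a b) => ab; [apply: W|apply/esym; apply: W].
  rewrite eqn_mod_dvd ?leq_exp2r // subn_sqr Euclid_dvdM // => /orP[] /dvdn_leq.
    by case: (posnP (b - a)) => [|_ /(_ isT)]; lia.
  by case: (posnP (b + a)) => [|_ /(_ isT)]; lia.
pose f (a : 'I_h.+1) : 'I_p := Ordinal (ltn_pmod (a ^ 2) p0).
pose g (a : 'I_h.+1) : 'I_p := Ordinal (ltn_pmod (p ^ 2 - (a ^ 2).+1) p0).
have lt_sq (a : 'I_h.+1) : ((a ^ 2).+1 <= p ^ 2)%N.
  by rewrite ltn_exp2r //; have := ltn_ord a; lia.
have ordh (a : 'I_h.+1) : (a <= h)%N by rewrite -ltnS.
have f_inj : injective f.
  by move=> a b [E]; apply/val_inj/(inj_sq _ _ (ordh a) (ordh b)).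
have g_inj : injective g.
  move=> a b [E]; apply/val_inj/(inj_sq _ _ (ordh a) (ordh b)).
  have {}E : (p ^ 2 - (a ^ 2).+1 + ((a ^ 2).+1 + (b ^ 2).+1) =
      p ^ 2 - (b ^ 2).+1 + ((a ^ 2).+1 + (b ^ 2).+1) %[mod p])%N.
    by rewrite -modnDml E modnDml.
  move: E; rewrite addnA subnK // [((a ^ 2).+1 + _)%N in RHS]addnC addnA subnK //.
  by move=> /eqP; rewrite eqn_modDl -(addn1 (a ^ 2)) -(addn1 (b ^ 2)) eqn_modDr => /eqP ->.
have [x] : exists x, x \in [set f a | a : 'I_h.+1] :&: [set g a | a : 'I_h.+1].
  apply/set0Pn; rewrite -card_gt0.
  have := cardsUI [set f a | a : 'I_h.+1] [set g a | a : 'I_h.+1].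
  rewrite !card_imset // card_ord.
  have := subset_leq_card (subsetT ([set f a | a : 'I_h.+1] :|: [set g a | a : 'I_h.+1])).
  by rewrite cardsT card_ord; move: #|_| #|_| => u v; lia.
case/setIP => /imsetP[a _ ->] /imsetP[b _ [E]].
have : (p %| a ^ 2 + b ^ 2 + 1)%N.
  rewrite /dvdn -addnA addn1 -modnDml E modnDml subnK // -mulnn.
  by rewrite modnMl.
case/dvdnP => m Em; exists a, b, m; split=> //.
  by rewrite lt0n; apply/eqP => m0; move: Em; rewrite m0; lia.
rewrite -(ltn_pmul2r p0) -Em.
have := leq_mul (ordh a) (ordh a); have := leq_mul (ordh b) (ordh b).
rewrite Ep -!mulnn; move: (a * a)%N (b * b)%N => u v; clear -p_gt1 Ep; nia.
Qed.

Lemma sum4_prime p : prime p -> sum4 p%:Z.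
Proof.
move=> pp; have p_gt1 := prime_gt1 pp.
have div1 (m : int) : 0 < m -> m < p%:Z -> forall k, p%:Z = m * k -> m = 1.
  move=> m0 mp k E; have : (`|m| %| p)%N by apply/dvdnP; exists `|k|%N; nia.
  by case/primeP: pp => _ H /H /orP[]/eqP; lia.
suff D (M : nat) (m : int) : m <= M%:Z -> 0 < m -> m < p%:Z -> sum4 (m * p%:Z) -> sum4 p%:Z.
  have [op|ep] := boolP (odd p).
    have [a [b [m [E m0 mp]]]] := minus_one_sum2 pp op.
    apply: (D m m) => //; exists a%:Z, b%:Z, 1, 0.
    by rewrite -PoszM -E; lia.
  have -> : p = 2%N by case/even_prime: pp ep => [->//|->].
  by exists 1, 1, 0, 0.
elim: M m => [|M IH] m mM m0 mp S; first lia.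
have [m1|[r [r0 rm Sr]]] := sum4_descent m0 mp S (div1 m m0 mp).
  by move: S; rewrite m1 mul1r.
by apply: (IH r) => //; lia.
Qed.

Theorem four_squares (n : nat) : sum4 n%:Z.
Proof.
have [N] := ubnP n; elim: N n => // N IH n nN.
case: n nN => [|[|n]] nN; first by exists 0, 0, 0, 0.
  by exists 1, 0, 0, 0.
have pp := pdiv_prime (isT : (1 < n.+2)%N).
rewrite -(divnK (pdiv_dvd n.+2)) PoszM; apply: sum4M; last exact: sum4_prime.
apply: IH; apply: leq_trans (nN : (n.+2 <= N)%N).
by apply: ltn_Pdiv => //; apply: prime_gt1.
Qed.

End FourSquares.

(** * Integer equations inside matrix equations *)

Section MatrixEquations.
Local Open Scope ring_scope.

Definition cterm := (int * seq nat)%type.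

Fixpoint pterms (p : pexp) : seq cterm :=
  match p with
  | PV i => [:: (1, [:: i])]
  | PC c => [:: (c, [::])]
  | PA p q => pterms p ++ pterms q
  | PM p q => [seq (x.1 * y.1, x.2 ++ y.2) | x <- pterms p, y <- pterms q]
  end.

Definition eval_terms (z : nat -> int) (ts : seq cterm) : int :=
  \sum_(t <- ts) t.1 * \prod_(v <- t.2) z v.

Lemma eval_pterms z p : eval_terms z (pterms p) = peval z p.
Proof.
rewrite /eval_terms; elim: p => [i|c|p IHp q IHq|p IHp q IHq] /=.
- by rewrite big_seq1 /= big_seq1 mul1r.
- by rewrite big_seq1 /= big_nil mulr1.
- by rewrite big_cat /= IHp IHq.
rewrite big_allpairs_dep /= -IHp -IHq big_distrl /=; apply: eq_bigr => x _.
rewrite big_distrr /=; apply: eq_bigr => y _.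
by rewrite big_cat /=; ring.
Qed.

Fixpoint pbound (p : pexp) : nat :=
  match p with
  | PV i => i.+1
  | PC c => 0
  | PA p q | PM p q => maxn (pbound p) (pbound q)
  end.

Lemma pterms_bound p t : t \in pterms p -> all (fun v => v < pbound p)%N t.2.
Proof.
elim: p t => [i|c|p IHp q IHq|p IHp q IHq] t /=.
- by rewrite inE => /eqP -> /=; rewrite ltnSn.
- by rewrite inE => /eqP ->.
- rewrite mem_cat => /orP[/IHp|/IHq]; apply: sub_all => v /= H; rewrite leq_max H //.
  by rewrite orbT.
case/allpairsP=> -[x y] /= [/IHp Hx /IHq Hy ->] /=; rewrite all_cat.
by apply/andP; split; [apply: sub_all Hx|apply: sub_all Hy] => v /= H;
  rewrite leq_max H // orbT.
Qed.

Lemma peval_bound z z' p : (forall i, (i < pbound p)%N -> z i = z' i) -> peval z p = peval z' p.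
Proof.
elim: p => [i|c|p IHp q IHq|p IHp q IHq] /= H; rewrite ?H //.
all: by rewrite IHp ?IHq // => i ip; apply: H; rewrite leq_max ip ?orbT.
Qed.

Lemma pbound_psub s p K : (forall i, (i < pbound p)%N -> (pbound (s i) <= K)%N) ->
  (pbound (psub s p) <= K)%N.
Proof.
elim: p => [i|c|p IHp q IHq|p IHp q IHq] /= H; rewrite ?H //.
all: by rewrite geq_max IHp ?IHq // => i ip; apply: H; rewrite leq_max ip ?orbT.
Qed.

Section NcEval.
Variables (n m : nat) (a : 'I_m -> 'M[int]_n).

Definition word_val (w : seq 'I_m) := \big[mulmx/1%:M]_(v <- w) a v.

Lemma nceval_supp (p : ncpoly m) (d : {fset {fmonom 'I_m}}) : (msupp p `<=` d)%fset ->
  nceval a p = \sum_(w <- d) (mcoeff w p)%:M *m word_val w.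
Proof.
move=> sub; rewrite /nceval; apply: big_fset_incl => // w _ wp.
by rewrite mcoeff_outdom // raddf0 mul0mx.
Qed.

Lemma nceval_add (p q : ncpoly m) : nceval a (p + q) = nceval a p + nceval a q.
Proof.
pose d := (msupp p `|` msupp q)%fset.
rewrite (@nceval_supp p d) ?fsubsetUl // (@nceval_supp q d) ?fsubsetUr //.
rewrite (@nceval_supp _ d) ?msuppD_le // -big_split; apply: eq_bigr => w _ /=.
by rewrite mcoeffD raddfD mulmxDl.
Qed.

Lemma nceval_terms (ts : terms m) :
  nceval a (poly_of_terms ts) = \sum_(t <- ts) t.1%:M *m word_val t.2.
Proof.
rewrite /poly_of_terms; elim: ts => [|t ts IH].
  by rewrite !big_nil /nceval msupp0 big_seq_fset0.
rewrite !big_cons nceval_add IH; congr (_ + _).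
rewrite (@nceval_supp _ [fset t.2]%fset) ?msuppU_le //.
by rewrite big_seq_fset1 mcoeffUU.
Qed.
End NcEval.

Definition pad_var (k v : nat) : 'I_(k + 1) := insubd (rshift k ord0) v.

Lemma val_pad_var k v : (v < k + 1)%N -> val (pad_var k v) = v.
Proof. by move=> H; rewrite /pad_var val_insubd H. Qed.

(** The parameter, variable [k], is placed around every unknown of a monomial. *)
Definition pad (k : nat) (vs : seq nat) := k :: flatten [seq [:: v; k] | v <- vs].

Definition mkterm k (t : cterm) : int * {fmonom 'I_(k + 1)} :=
  (t.1, FMonom [seq pad_var k v | v <- pad k t.2]).

Definition nats_of_cterm k (t : cterm) : seq nat :=
  nats_of_int t.1 ++ size (pad k t.2) :: pad k t.2.

Lemma nats_of_mkterm k t : all (fun v => v < k)%N t.2 ->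
  nats_of_term (mkterm k t) = nats_of_cterm k t.
Proof.
move=> Ht; rewrite /nats_of_term /nats_of_cterm.
have Hc v : (v <= k)%N -> nat_of_ord (pad_var k v) = v.
  by move=> vk; apply: val_pad_var; rewrite addn1.
suff -> : [seq val v | v <- ((mkterm k t).2 : seq 'I_(k + 1))] = pad k t.2.
  by rewrite size_map.
rewrite -map_comp; apply: map_id_in => v; rewrite inE => /predU1P[->|].
  exact: Hc.
move=> /flatten_mapP[u /(allP Ht) uk].
by rewrite !inE => /orP[]/eqP -> /=; apply: Hc => //; apply: ltnW.
Qed.

Section Equation.
Variables (n : nat) (i0 : 'I_n) (k : nat).
Let E : 'M[int]_n := delta_mx i0 i0.

Definition unit_eqn (ts : seq cterm) : nc_equation n :=
  NCEquation (poly_of_terms [seq mkterm k t | t <- ts]) [tuple E].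

Lemma corner (A : 'M[int]_n) : E *m A *m E = A i0 i0 *: E.
Proof.
apply/matrixP => i j; rewrite !mxE (bigD1 i0) //= big1 => [|l li].
  rewrite !mxE (bigD1 i0) //= big1 => [|l li]; last by rewrite !mxE (negbTE li) andbF mul0r.
  by rewrite !mxE !eqxx !addr0 andbT /=; case: eqP; case: eqP => _ _ /=; ring.
by rewrite !mxE (negbTE li) mulr0.
Qed.

Variable X : k.-tuple 'M[int]_n.
Definition corner_val (v : nat) : int := (nth 0 X v) i0 i0.

Lemma assignment_unknown v : (v < k)%N ->
  assignment X [tuple E] (pad_var k v) = nth 0 X v.
Proof.
move=> vk; have -> : pad_var k v = lshift 1 (Ordinal vk).
  by apply: val_inj; rewrite val_pad_var // addn1 ltnW.
by rewrite /assignment (unsplitK (inl (Ordinal vk))) (tnth_nth 0).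
Qed.

Lemma assignment_param : assignment X [tuple E] (pad_var k k) = E.
Proof.
have -> : pad_var k k = rshift k ord0.
  by apply: val_inj; rewrite val_pad_var ?addn1 //= addn0.
by rewrite /assignment (unsplitK (inr ord0)).
Qed.

Lemma word_pad vs : all (fun v => v < k)%N vs ->
  word_val (assignment X [tuple E]) [seq pad_var k v | v <- pad k vs]
  = (\prod_(v <- vs) corner_val v) *: E.
Proof.
move=> Hvs; rewrite /word_val /= big_cons assignment_param.
suff H c : (c *: E) *m
   \big[mulmx/1%:M]_(v <- [seq pad_var k v | v <- flatten [seq [:: v; k] | v <- vs]])
     assignment X [tuple E] v = (c * \prod_(v <- vs) corner_val v) *: E.
  by have := H 1; rewrite scale1r mul1r.
elim: vs c Hvs => [|v vs IH] c /=; first by rewrite !big_nil mulmx1 mulr1.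
case/andP=> vk Hvs; rewrite !big_cons assignment_param assignment_unknown //.
rewrite !mulmxA -!scalemxAl corner -!scalemxAl scalerA mulrA.
by have := IH (c * corner_val v) Hvs; rewrite -scalemxAl.
Qed.

Lemma nceval_unit_eqn ts : all (fun t => all (fun v => v < k)%N t.2) ts ->
  nceval (assignment X [tuple E]) (poly_of_terms [seq mkterm k t | t <- ts])
  = eval_terms corner_val ts *: E.
Proof.
move=> Hts; rewrite nceval_terms big_map /eval_terms scaler_suml.
rewrite big_seq [RHS]big_seq; apply: eq_bigr => t /(allP Hts) Ht.
by rewrite word_pad // mul_scalar_mx scalerA.
Qed.
End Equation.

Lemma unit_eqn_solvable n (i0 : 'I_n) k (S : {pred int}) ts : 0 \in S ->
  all (fun t => all (fun v => v < k)%N t.2) ts ->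
  has_solution_in S (unit_eqn i0 k ts) <->
  exists z : nat -> int, (forall i, z i \in S) /\ eval_terms z ts = 0.
Proof.
move=> S0 Hts; split.
  case=> X [HX]; rewrite nceval_unit_eqn //= => /matrixP /(_ i0 i0).
  rewrite !mxE !eqxx mulr1 => E; exists (corner_val i0 X); split=> // v.
  rewrite /corner_val; have [vk|kv] := ltnP v k.
    by have /mxOverP := HX (Ordinal vk); rewrite (tnth_nth 0); apply.
  by rewrite nth_default ?size_tuple // mxE.
case=> z [HS E]; exists [tuple z i *: delta_mx i0 i0 | i < k]; split.
  move=> i; rewrite tnth_mktuple; apply/mxOverP => r c; rewrite !mxE.
  by case: (_ && _); rewrite ?mulr1 ?mulr0.
rewrite nceval_unit_eqn //= (_ : eval_terms _ ts = 0) ?scale0r // -[RHS]E.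
rewrite /eval_terms big_seq [RHS]big_seq; apply: eq_bigr => t /(allP Hts) Ht; congr (_ * _).
rewrite big_seq [RHS]big_seq; apply: eq_bigr => v /(allP Ht) vk.
by rewrite /corner_val -(tnth_nth 0 _ (Ordinal vk)) tnth_mktuple !mxE !eqxx mulr1.
Qed.

Lemma unit_eqn_params n (i0 : 'I_n) k (B : {pred int}) ts : 0 \in B -> 1 \in B ->
  has_params_in B (unit_eqn i0 k ts).
Proof.
move=> B0 B1 j; rewrite (tnth_nth 0) /= ord1 /=; apply/mxOverP => r c; rewrite !mxE.
by case: (_ && _).
Qed.

Lemma codes_unit_eqn n (i0 : 'I_n) k ts : all (fun t => all (fun v => v < k)%N t.2) ts ->
  codes_equation (unit_eqn i0 k ts)
    (unary (k :: 1%N :: nats_of_mx (delta_mx i0 i0 : 'M[int]_n) ++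
            flatten [seq nats_of_cterm k t | t <- ts])).
Proof.
move=> Hts; exists [seq mkterm k t | t <- ts]; split=> //=.
rewrite cats0 -map_comp; congr (unary (_ :: _ :: _ ++ flatten _)).
by apply/eq_in_map => t /(allP Hts) Ht; rewrite /= nats_of_mkterm.
Qed.

End MatrixEquations.

(** * The self-referential equation *)

Local Open Scope ring_scope.

(** The terms of (X0 - (q + 1))^2. With [q + 1] in place of [q] the linear coefficient
    is negative for every [q], and its sign in the code word is constant. *)
Definition shift_terms (q : nat) : seq cterm :=
  [:: (1, [:: 0; 0]%N); (Negz q, [:: 0%N]); (Negz q, [:: 0%N]);
      (Posz (q.+1 * q.+1), [::])].

Lemma eval_shift_terms z q : eval_terms z (shift_terms q) = (z 0%N - Posz q.+1) ^+ 2.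
Proof.
rewrite /eval_terms !big_cons !big_nil /= NegzE PoszM; move: (Posz q.+1) => c; ring.
Qed.

(** The polynomial [f], in four variables ranging over [S], takes exactly the natural
    numbers as values. *)
Definition covers_nat (S : {pred int}) (f : pexp) :=
  [/\ (forall n : nat, Posz n \in S), (pbound f <= 4)%N,
      (forall z : nat -> int, (forall i, z i \in S) -> 0 <= peval z f) &
      (forall n : nat, exists s : seq int,
         all (fun x => x \in S) s && (peval (nth 0 s) f == Posz n))].

Lemma nat_covers_nat : covers_nat Num.nat (PV 0).
Proof.
have S (n : nat) : Posz n \in Num.nat by rewrite -natz natr_nat.
split=> //=; first by move=> z /(_ 0%N); apply: natr_ge0.
by move=> n; exists [:: Posz n]; apply/andP; split=> //; apply/andP; split=> //; apply: S.
Qed.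

Definition sum4_exp :=
  PA (PA (PM (PV 0) (PV 0)) (PM (PV 1) (PV 1))) (PA (PM (PV 2) (PV 2)) (PM (PV 3) (PV 3))).

Lemma int_covers_nat : covers_nat predT sum4_exp.
Proof.
split=> //=.
  by move=> z _; rewrite -!expr2 !addr_ge0 ?sqr_ge0.
move=> n; have [a [b [c [d E]]]] := four_squares n.
by exists [:: a; b; c; d] => /=; rewrite E; apply/eqP; ring.
Qed.

(** The arguments of a binary relation become the constant [k] and the number
    [X0 - 1]; the witness of index [i./2] becomes a value of [f] on its own four
    unknowns. *)
Definition unknowns (f : pexp) (k : nat) (i : nat) : pexp :=
  if odd i then psub (fun j => PV (4 * i./2 + j).+1) f
  else if i == 0%N then PC (Posz k)
  else if i == 2%N then PA (PV 0) (PC (-1)) else PC 0.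

Lemma peval_unknowns (S : {pred int}) f k q p : covers_nat S f ->
  (exists mu, peval (join (fun i => nth 0 [:: k; q] i)%N mu) p = 0) <->
  exists z : nat -> int, [/\ forall i, z i \in S, z 0%N = Posz q.+1 &
     peval z (psub (unknowns f k) p) = 0].
Proof.
case=> Snat fb f0 fn.
have key (z : nat -> int) mu : z 0%N = Posz q.+1 ->
    (forall i, peval (fun j => z (4 * i + j).+1) f = Posz (mu i)) ->
    peval z (psub (unknowns f k) p) = peval (join (fun i => nth 0 [:: k; q] i)%N mu) p.
  move=> z0 Hz; rewrite peval_psub; apply: eq_peval => i; rewrite /unknowns /join.
  case Oi: (odd i); first by rewrite peval_psub /= Hz.
  case: i Oi => [|[|[|[|i]]]] //=; first by rewrite z0; lia.
  by rewrite nth_nil.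
split.
  case=> mu E; pose g i := nth 0 (sval (sigW (fn (mu i)))).
  have Hg i : (forall j, g i j \in S) /\ peval (g i) f = Posz (mu i).
    rewrite /g; case: (sigW _) => /= s /andP[/allP Hs /eqP ->]; split=> // j.
    have [js|sj] := ltnP j (size s); first by apply: Hs; apply: mem_nth.
    by rewrite nth_default //; apply: (Snat 0%N).
  exists (fun m => if m is m'.+1 then g (m' %/ 4)%N (m' %% 4)%N else Posz q.+1).
  split=> //; first by case=> [|i]; [apply: Snat|have [] := Hg (i %/ 4)%N].
  rewrite (key _ mu) // => i; have [_ <-] := Hg i; apply: peval_bound => j jf.
  have j4 : (j < 4)%N by apply: leq_trans fb.
  by rewrite mulnC divnMDl // divn_small // addn0 modnMDl modn_small.
case=> z [HS z0 E]; exists (fun i => `|peval (fun j => z (4 * i + j).+1) f|%N).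
by rewrite -(key z) // => i; have := f0 (fun j => z (4 * i + j).+1) (fun j => HS _); lia.
Qed.

(** The bound does not depend on [k], which is what allows the number of unknowns
    to occur in the equation as a constant. *)
Lemma pbound_unknowns f k p : (pbound f <= 4)%N ->
  (pbound (psub (unknowns f k) p) <= 4 * pbound p + 5)%N.
Proof.
move=> fb; apply: pbound_psub => i ip; rewrite /unknowns.
case: ifP => [_|_]; last by do 2?case: ifP => _ //=; lia.
apply: pbound_psub => j jf /=; have : (i./2 <= i)%N by rewrite leq_half_double; lia.
lia.
Qed.

Lemma unary_cat l1 l2 : unary (l1 ++ l2) = unary l1 ++ unary l2.
Proof. by rewrite /unary map_cat flatten_cat. Qed.

(** The polynomial [p] expresses, for every [k] and [q], that [M] rejects a word that
    starts with [prefix k q] and continues with a tape of number [q]. For the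
    [k] and [q] built from [p] itself, this is a code word of the equation
    which is solvable exactly if [p] has a solution. *)
Lemma undecidable_solvability_of_cover n (hn : (1 <= n)%N) (B S : {pred int}) f :
  0 \in B -> 1 \in B -> covers_nat S f -> undecidable_solvability n B S.
Proof.
move=> B0 B1 cov [M dec]; have [Snat fb _ _] := cov.
pose i0 : 'I_n := Ordinal hn.
pose header := nats_of_mx (delta_mx i0 i0 : 'M[int]_n).
pose prefix (k q : nat) : seq nat := [:: k; 1%N] ++ header ++
   flatten [seq nats_of_cterm k t | t <- shift_terms q].
have [p Hp] : dio (fun nu => rejects M (prefix (nu 0%N) (nu 1%N)) (nu 1%N)).
  pose k := (fun nu : env => nu 0%N); pose q1 := (fun nu : env => (nu 1%N).+1).
  pose c (x : nat) := (fun nu : env => x).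
  (* [prefix] with its entries as functions of the two arguments, the four terms
     of [shift_terms] spelled out *)
  pose l : seq (env -> nat) := [:: k; c 1%N] ++ map c header ++
    [:: c 0; c 1; c 5; k; c 0; k; c 0; k; c 1; q1; c 3; k; c 0; k; c 1; q1; c 3; k; c 0; k;
        c 0; (fun nu => q1 nu * q1 nu); c 1; k]%N.
  have Hl : forall f, List.In f l -> dfun f.
    have Hk : dfun k by apply: dfun_proj.
    have Hc x : dfun (c x) by apply: dfun_const.
    have Hq : dfun q1 by apply: dfun_S; apply: dfun_proj.
    have Hqq : dfun (fun nu => q1 nu * q1 nu)%N by apply: dfun_mul.
    move=> g; rewrite /l; case=> [<-//|[<-//|]].
    elim: (header) => [|x s IH] /=; last by case=> [<-//|/IH].
    by repeat case=> [<-//|].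
  apply: dio_iff (dio_rejects M Hl (dfun_proj 1)) => nu.
  suff -> : [seq f nu | f <- l] = prefix (nu 0%N) (nu 1%N) by [].
  rewrite /l /prefix !map_cat -map_comp; congr (_ ++ (_ ++ _)).
  by rewrite map_id_in.
pose k := (4 * pbound p + 5)%N.
pose P := psub (unknowns f k) p.
pose W := unary (flatten [seq nats_of_cterm k t | t <- pterms (PM P P)]).
(* [W] depends on [k] but not on [q], so there is no circularity. *)
pose q := tape M W.
pose ts := shift_terms q ++ pterms (PM P P).
have k0 : (0 < k)%N by rewrite /k addnS.
have Hts : all (fun t => all (fun v => v < k)%N t.2) ts.
  rewrite all_cat; apply/andP; split; first by rewrite /= k0.
  apply/allP => t /pterms_bound; apply: sub_all => v /= vP; apply: leq_trans vP _.
  by rewrite maxnn; apply: pbound_unknowns.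
have coded := codes_unit_eqn i0 Hts.
have [b [Hb Yb]] := dec _ _ (@unit_eqn_params n i0 k B ts B0 B1) coded.
have sol : has_solution_in S (unit_eqn i0 k ts) <-> rejects M (prefix k q) q.
  rewrite unit_eqn_solvable //; last exact: (Snat 0%N).
  have := Hp (fun i => nth 0%N [:: k; q] i); rewrite /= => ->.
  rewrite (peval_unknowns _ _ _ cov) -/P; split.
    case=> z [HS]; rewrite /ts /eval_terms big_cat -!/(eval_terms _ _) eval_shift_terms eval_pterms /= => E.
    have : z 0%N - Posz q.+1 = 0 /\ peval z P = 0.
      by move: E; move: (z 0%N - _) (peval z P) => x y E; split; nia.
    by case=> E1 E2; exists z; split=> //; lia.
  case=> z [HS z0 E]; exists z; split=> //.
  by rewrite /ts /eval_terms big_cat -!/(eval_terms _ _) eval_shift_terms eval_pterms /= z0 E; ring.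
have word : unary (k :: 1%N :: header ++ flatten [seq nats_of_cterm k t | t <- ts])
    = unary (prefix k q) ++ W.
  by rewrite /W -unary_cat /ts map_cat flatten_cat /prefix -!catA.
have rej : rejects M (prefix k q) q <-> halts_with M (unary (prefix k q) ++ W) false.
  exact: rejectsP.
rewrite word in Hb; case: b Hb Yb => Hb Yb.
  have /sol/rej Hf := proj1 Yb isT.
  by have := halts_with_det Hb Hf.
by have := proj2 Yb (proj2 sol (proj2 rej Hb)).
Qed.

Theorem theorem4p1 (n : nat) (hn : (1 <= n)%N) :
  [/\ undecidable_solvability n predT Num.nat,
      undecidable_solvability n predT predT,
      undecidable_solvability n (pred2 0 1) Num.nat
    & undecidable_solvability n (pred2 0 1) predT].
Proof.
split.
- exact: (undecidable_solvability_of_cover hn isT isT nat_covers_nat).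
- exact: (undecidable_solvability_of_cover hn isT isT int_covers_nat).
- exact: (undecidable_solvability_of_cover hn isT isT nat_covers_nat).
- exact: (undecidable_solvability_of_cover hn isT isT int_covers_nat).
Qed.
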